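(* There exists a universal constant $K>0$ such that the following holds. Let $p\ge 1$ be an integer, let $f(z)=\sum_{k=0}^\infty a_k z^k$ be a $p$-valent function on the unit disk $D_1$, and let $R>1$. Then for every $R'$ with $0<R'<R$, the Borel transform $B(f)(z)=\sum_{k=0}^\infty \frac{a_k}{k!}z^k$ is $q$-valent on $D_{R'}$ for some positive integer $q$ satisfying $$ q\le K\big((1+\log p+\log R)\,p+R\big). $$
   Context: For $\rho>0$, $D_\rho\subset\mathbb{C}$ denotes the open disk of radius $\rho$ centered at $0$. A function $f$ that is regular (i.e. analytic) in a domain $\Omega\subset\mathbb{C}$ is called $p$-valent in $\Omega$ if for any $c\in\mathbb{C}$ the number of solutions in $\Omega$ of the equation $f(z)=c$ does not exceed $p$. For an analytic function $f(z)=\sum_{k=0}^\infty a_k z^k$ with nonzero radius of convergence, its Borel transform is the entire function $B(f)(z)=\sum_{k=0}^\infty \frac{a_k}{k!}z^k$. A universal constant is one independent of $f$, $p$, $R$ and $R'$. *)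

(* Defs.v *)
From Stdlib Require Import Reals List Factorial.
From Coquelicot Require Import Coquelicot.

Open Scope R_scope.

Definition disk (rho : R) (z : C) : Prop := Cmod z < rho.

(* Differentiability over [C_AbsRing] is complex differentiability. *)
Definition regular_on (Omega : C -> Prop) (f : C -> C) : Prop :=
  forall z : C, Omega z -> ex_derive (K := C_AbsRing) (V := C_NormedModule) f z.

(* Distinct solutions are counted.  On a nonempty domain, counting them with
   multiplicity gives the same notion, because a zero of order m of [f - c]
   splits into m simple ones when c is perturbed. *)
Definition valent (p : nat) (Omega : C -> Prop) (f : C -> C) : Prop :=
  regular_on Omega f /\
  forall (c : C) (l : list C),
    NoDup l -> (forall z, In z l -> Omega z /\ f z = c) -> (length l <= p)%nat.

(* Coquelicot's [PSeries] is restricted to real coefficients.  The value is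
   unspecified where the series diverges. *)
Definition CPSeries (a : nat -> C) (z : C) : C :=
  iota (T := C_CompleteNormedModule)
    (fun s : C => is_pseries (K := C_AbsRing) (V := C_NormedModule) a z s).

Definition Borel_transform (a : nat -> C) : C -> C :=
  CPSeries (fun k => (a k / RtoC (INR (fact k)))%C).

(* Main.v *)
Require Import Defs.
From Stdlib Require Import Reals ZArith List FinFun Lra Lia Classical.
From Coquelicot Require Import Coquelicot.

(** Notation for this overview: [|a|_r] is the sum of [|a_k| r^k], and [D_r] is
    the disk of radius [r] about 0. Everything is done with power series and
    these norms; [C] stands for absolute constants.

    The theorem follows from a domination property of [p]-valent functions and a
    zero count. Let [f] be [p]-valent with coefficients [a], and let
    [S = |a|_d] for a small absolute [d]. The property to establish is that
    [|f| <= C S / d^(3p)] on [D_(1/256)] (lemma [growth]). By Cauchy's estimate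
    [|a_k| <= 256^k C S / d^(3p)], so the part of [S] that comes from the indices
    [k >= 4p] is at most [2 C S (256^4 d)^p], hence at most [S / 2] once [d] is
    chosen small. Thus [S] is carried, up to a factor 2, by the first [4p]
    coefficients ([domination]). Now suppose that [g = B(f) - c] has [n] zeros
    in [D_rho]. Dividing out the linear factors gives [2^n |g|_1 <= |g|_(9 rho)]
    ([root_count]). Since [f - c] is [p]-valent too, domination applies to it: it
    gives [|g|_1 >= S / (2 (4p)!)] and
    [|g|_(9 rho) <= C S d^(-3p) exp(2304 rho)], and taking logarithms yields
    [n <= C (p log p + p + rho)], slightly more than the claim.

    For [growth], choose [c] with [2S < |c| < 3S]. Then [f - c] has at most [p]
    zeros in [D_(1/8)], and none in [D_d], where [|f| <= S]. Dividing them out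
    leaves a zero-free [b] with [|b(0)| <= 4 S / d^p], and [|f - c| <= |b|] near
    0. Let [L = log (b / S)]. An upper bound for [Re L] near 0 comes from the
    coefficients of [L], which are at most twice the mean of [|Re L|] over a
    circle. That mean is the mean of [Re L], which is
    [Re L(0) <= log (4 / d^p)], plus twice the mean of the negative part of
    [Re L], which is at most the mean of the negative part of
    [log (|f - c| / S)]. So [c] must be a value to which [f] is not too close on
    average. Such a [c] exists because the monic polynomial
    whose roots are the sampled values of [f] cannot be small on a
    whole circle ([exists_remote_value]); the mean is then at most [log 7].
    This replaces the average over all [c] in Cartan's identity by one choice.
    Means are taken over finitely many roots of unity. The chosen [c] depends on
    how many there are, so the sampling error has to be bounded uniformly in [c];
    the Borel-Caratheodory inequality does this ([log_majorant]).

    Two points need care. Valency counts distinct solutions, so [c] also avoids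
    the finitely many critical values, which makes the zeros of [f - c] simple.
    And [log b] must be given by a series that converges on a fixed disk. This
    reduces to the convergence of the series of [1 / b], for which
    [summable_inverse] gives a continuity argument that uses no contour integral.

    The radii 3/4, 1/8, 1/32, 1/64, 1/128, 1/256 used below are, in this order:
    where norms are taken, where zeros are removed, where [L] converges, where
    Borel-Caratheodory is applied, where [f] is sampled, where [f] is bounded. *)

(** * Finite sums *)

Fixpoint rsum (u : nat -> R) (n : nat) : R :=
  match n with O => 0 | S m => rsum u m + u m end.

Fixpoint csum (u : nat -> C) (n : nat) : C :=
  match n with O => RtoC 0 | S m => (csum u m + u m)%C end.

Lemma rsum_ext u v n : (forall k, (k < n)%nat -> u k = v k) -> rsum u n = rsum v n.
Proof.
  induction n as [|n IH]; intros H; simpl; [reflexivity|].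
  rewrite IH, H by (try intros; try apply H; lia). reflexivity.
Qed.

Lemma rsum_le u v n : (forall k, (k < n)%nat -> u k <= v k) -> rsum u n <= rsum v n.
Proof.
  induction n as [|n IH]; intros H; simpl; [lra|].
  apply Rplus_le_compat; [apply IH; intros; apply H|apply H]; lia.
Qed.

Lemma rsum_scal c u n : rsum (fun k => c * u k) n = c * rsum u n.
Proof. induction n as [|n IH]; simpl; [|rewrite IH]; ring. Qed.

Lemma rsum_plus u v n : rsum (fun k => u k + v k) n = rsum u n + rsum v n.
Proof. induction n as [|n IH]; simpl; [|rewrite IH]; ring. Qed.

Lemma rsum_const c n : rsum (fun _ => c) n = INR n * c.
Proof. induction n as [|n IH]; [simpl; ring|]. rewrite S_INR; simpl; rewrite IH; ring. Qed.

Lemma rsum_nonneg u n : (forall k, (k < n)%nat -> 0 <= u k) -> 0 <= rsum u n.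
Proof.
  intros H. replace 0 with (rsum (fun _ => 0) n) by (rewrite rsum_const; ring).
  now apply rsum_le.
Qed.

Lemma rsum_S_l u n : rsum u (S n) = u 0%nat + rsum (fun k => u (S k)) n.
Proof. induction n as [|n IH]; [simpl; ring|]. change (rsum u (S (S n))) with (rsum u (S n) + u (S n)). rewrite IH. simpl. ring. Qed.

Lemma rsum_incr u n m : (forall k, 0 <= u k) -> (n <= m)%nat -> rsum u n <= rsum u m.
Proof.
  intros H. induction 1 as [|m _ IH]; simpl; [lra|]. specialize (H m); lra.
Qed.

Lemma rsum_geom x n : x <> 1 -> rsum (fun k => x ^ k) n = (1 - x ^ n) / (1 - x).
Proof.
  intros H. induction n as [|n IH]; simpl; [|rewrite IH]; field; lra.
Qed.

Lemma rsum_geom_le x n : 0 <= x < 1 -> rsum (fun k => x ^ k) n <= / (1 - x).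
Proof.
  intros H. rewrite rsum_geom by lra. unfold Rdiv.
  rewrite <- (Rmult_1_l (/ (1 - x))) at 2.
  apply Rmult_le_compat_r; [left; apply Rinv_0_lt_compat; lra|].
  pose proof (pow_le x n (proj1 H)); lra.
Qed.

Lemma sum_n_rsum (u : nat -> R) n : sum_n u n = rsum u (S n).
Proof.
  induction n as [|n IH]; [rewrite sum_O; simpl; ring|].
  rewrite sum_Sn, IH. reflexivity.
Qed.

Lemma csum_ext u v n : (forall k, (k < n)%nat -> u k = v k) -> csum u n = csum v n.
Proof.
  induction n as [|n IH]; intros H; simpl; [reflexivity|].
  rewrite IH, H by (try intros; try apply H; lia). reflexivity.
Qed.

Lemma csum_scal c u n : csum (fun k => (c * u k)%C) n = (c * csum u n)%C.
Proof. induction n as [|n IH]; simpl; [|rewrite IH]; ring. Qed.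

Lemma csum_plus u v n : csum (fun k => (u k + v k)%C) n = (csum u n + csum v n)%C.
Proof. induction n as [|n IH]; simpl; [|rewrite IH]; ring. Qed.

Lemma csum_0 n : csum (fun _ => RtoC 0) n = RtoC 0.
Proof. induction n as [|n IH]; simpl; [|rewrite IH]; ring. Qed.

Lemma csum_S_l u n : csum u (S n) = (u 0%nat + csum (fun k => u (S k)) n)%C.
Proof. induction n as [|n IH]; [simpl; ring|]. change (csum u (S (S n))) with (csum u (S n) + u (S n))%C. rewrite IH. simpl. ring. Qed.

Lemma Cmod_csum u n : Cmod (csum u n) <= rsum (fun k => Cmod (u k)) n.
Proof.
  induction n as [|n IH]; simpl; [rewrite Cmod_0; lra|].
  eapply Rle_trans; [apply Cmod_triangle|lra].
Qed.

Lemma Re_csum u n : Re (csum u n) = rsum (fun k => Re (u k)) n.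
Proof. induction n as [|n IH]; simpl; [reflexivity|]. now rewrite <- IH. Qed.

Lemma Im_csum u n : Im (csum u n) = rsum (fun k => Im (u k)) n.
Proof. induction n as [|n IH]; simpl; [reflexivity|]. now rewrite <- IH. Qed.

Lemma csum_swap (u : nat -> nat -> C) n m :
  csum (fun i => csum (u i) m) n = csum (fun j => csum (fun i => u i j) n) m.
Proof.
  induction n as [|n IH]; simpl; [now rewrite csum_0|].
  rewrite IH, <- csum_plus. reflexivity.
Qed.

Lemma Cmod_le_Re_Im z : Cmod z <= Rabs (Re z) + Rabs (Im z).
Proof.
  destruct z as [x y].
  replace (Cmod (x, y)) with (Cmod (RtoC x + Ci * RtoC y)%C).
  2:{ f_equal. unfold RtoC, Ci, Cplus, Cmult; simpl; f_equal; ring. }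
  eapply Rle_trans; [apply Cmod_triangle|].
  rewrite Cmod_mult, Cmod_Ci, !Cmod_R. unfold Re, Im; simpl.
  lra.
Qed.

Lemma im_le_Cmod z : Rabs (Im z) <= Cmod z.
Proof. eapply Rle_trans; [|apply Rmax_Cmod]. apply Rmax_r. Qed.

(** * Absolutely convergent power series *)

Definition partial_norm (a : nat -> C) (r : R) (n : nat) : R :=
  rsum (fun k => Cmod (a k) * r ^ k) n.

Definition summable (a : nat -> C) (r : R) : Prop :=
  ex_series (fun k => Cmod (a k) * r ^ k).

Definition l1norm (a : nat -> C) (r : R) : R := Series (fun k => Cmod (a k) * r ^ k).

Definition psum (a : nat -> C) (z : C) (n : nat) : C := csum (fun k => (a k * z ^ k)%C) n.

(** The sum of the series, taken componentwise so that it is a total function; it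
    is meaningful when [summable a r] and [Cmod z <= r]. *)
Definition ev (a : nat -> C) (z : C) : C :=
  (Series (fun k => Re (a k * z ^ k)), Series (fun k => Im (a k * z ^ k))).

Definition remainder (a : nat -> C) (r : R) (n : nat) : R := l1norm a r - partial_norm a r n.

Lemma term_nonneg (a : nat -> C) r k : 0 <= r -> 0 <= Cmod (a k) * r ^ k.
Proof. intros. apply Rmult_le_pos; [apply Cmod_ge_0|now apply pow_le]. Qed.

Lemma partial_norm_incr a r n m :
  0 <= r -> (n <= m)%nat -> partial_norm a r n <= partial_norm a r m.
Proof. intros Hr. apply rsum_incr. intros; now apply term_nonneg. Qed.

Lemma partial_norm_nonneg a r n : 0 <= r -> 0 <= partial_norm a r n.
Proof. intros Hr. apply rsum_nonneg. intros; now apply term_nonneg. Qed.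

Lemma is_lim_seq_rsum (u : nat -> R) l : is_series u l -> is_lim_seq (rsum u) l.
Proof.
  intros H. apply is_lim_seq_incr_1.
  apply is_lim_seq_ext with (sum_n u); [apply sum_n_rsum|exact H].
Qed.

Lemma is_series_rsum (u : nat -> R) (l : R) : is_lim_seq (rsum u) l -> is_series u l.
Proof.
  intros H. apply is_lim_seq_incr_1 in H.
  apply (is_lim_seq_ext _ (sum_n u)) in H; [exact H|].
  intros n. symmetry; apply sum_n_rsum.
Qed.

Lemma partial_norm_lim a r : summable a r -> is_lim_seq (partial_norm a r) (l1norm a r).
Proof. intros H. apply is_lim_seq_rsum, Series_correct, H. Qed.

Lemma partial_norm_le a r n : 0 <= r -> summable a r -> partial_norm a r n <= l1norm a r.
Proof.
  intros Hr H.
  refine (is_lim_seq_incr_compare _ _ (partial_norm_lim a r H) _ n).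
  intros k. apply partial_norm_incr; [assumption|lia].
Qed.

Lemma summable_bounded a r M :
  0 <= r -> (forall n, partial_norm a r n <= M) -> summable a r /\ l1norm a r <= M.
Proof.
  intros Hr HM.
  destruct (ex_finite_lim_seq_incr (partial_norm a r) M) as [l Hl].
  - intros n; apply partial_norm_incr; [assumption|lia].
  - assumption.
  - pose proof (is_series_rsum _ _ Hl) as Hs. split; [now exists l|].
    unfold l1norm. rewrite (is_series_unique _ _ Hs).
    exact (is_lim_seq_le _ (fun _ => M) l M HM Hl (is_lim_seq_const M)).
Qed.

Lemma l1norm_nonneg a r : 0 <= r -> summable a r -> 0 <= l1norm a r.
Proof. intros Hr H. exact (partial_norm_le a r 0 Hr H). Qed.

Lemma remainder_nonneg a r n : 0 <= r -> summable a r -> 0 <= remainder a r n.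
Proof. intros Hr H. unfold remainder. pose proof (partial_norm_le a r n Hr H); lra. Qed.

Lemma remainder_lim a r : summable a r -> is_lim_seq (remainder a r) 0.
Proof.
  intros H. unfold remainder. replace 0 with (l1norm a r - l1norm a r) by ring.
  apply is_lim_seq_minus'; [apply is_lim_seq_const|now apply partial_norm_lim].
Qed.

Lemma remainder_decr a r n m : 0 <= r -> (n <= m)%nat -> remainder a r m <= remainder a r n.
Proof. intros Hr Hnm. unfold remainder. pose proof (partial_norm_incr a r n m Hr Hnm); lra. Qed.

Lemma remainder_lt a r eps : 0 < eps -> 0 <= r -> summable a r ->
  exists n, forall m, (n <= m)%nat -> remainder a r m < eps.
Proof.
  intros He Hr H. apply remainder_lim, is_lim_seq_spec in H.
  destruct (H (mkposreal eps He)) as [n Hn]. exists n. intros m Hm.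
  specialize (Hn m Hm). simpl in Hn. rewrite Rminus_0_r in Hn.
  eapply Rle_lt_trans; [apply Rle_abs|exact Hn].
Qed.

Lemma summable_le a b r s :
  0 <= r -> summable b s -> (forall k, Cmod (a k) * r ^ k <= Cmod (b k) * s ^ k) ->
  summable a r /\ l1norm a r <= l1norm b s.
Proof.
  intros Hr Hb H.
  assert (Hp : forall k, 0 <= Cmod (a k) * r ^ k <= Cmod (b k) * s ^ k).
  { intros k; split; [now apply term_nonneg|apply H]. }
  split; [|now apply Series_le].
  apply (ex_series_le (K := R_AbsRing) (V := R_CompleteNormedModule) _ _) with (2 := Hb).
  intros k. specialize (Hp k).
  change (norm (Cmod (a k) * r ^ k)) with (Rabs (Cmod (a k) * r ^ k)).
  rewrite Rabs_pos_eq; lra.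
Qed.

Lemma summable_radius a r s :
  0 <= r <= s -> summable a s -> summable a r /\ l1norm a r <= l1norm a s.
Proof.
  intros Hr H. apply summable_le; [lra|assumption|].
  intros k. apply Rmult_le_compat_l; [apply Cmod_ge_0|now apply pow_incr].
Qed.

Lemma term_le_l1norm a r k : 0 <= r -> summable a r -> Cmod (a k) * r ^ k <= l1norm a r.
Proof.
  intros Hr H. eapply Rle_trans; [|apply (partial_norm_le a r (S k) Hr H)].
  unfold partial_norm; simpl. pose proof (partial_norm_nonneg a r k Hr).
  unfold partial_norm in *; lra.
Qed.

Lemma summable_of_bound a r s M :
  0 <= r < s -> 0 <= M -> (forall k, Cmod (a k) * s ^ k <= M) ->
  summable a r /\ l1norm a r <= M / (1 - r / s).
Proof.
  intros Hr HM H. apply summable_bounded; [lra|]. intros n.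
  assert (Hx : 0 <= r / s < 1).
  { split; [apply Rdiv_le_0_compat; lra|]. apply Rlt_div_l; lra. }
  apply Rle_trans with (rsum (fun k => M * (r / s) ^ k) n).
  - apply rsum_le. intros k _.
    replace (Cmod (a k) * r ^ k) with ((Cmod (a k) * s ^ k) * (r / s) ^ k).
    + apply Rmult_le_compat_r; [apply pow_le, Hx|apply H].
    + unfold Rdiv. rewrite Rpow_mult_distr, pow_inv. field.
      apply pow_nonzero; lra.
  - rewrite rsum_scal. apply Rmult_le_compat_l; [assumption|].
    now apply rsum_geom_le.
Qed.

Lemma Cmod_term a z r k : Cmod z <= r -> Cmod (a k * z ^ k)%C <= Cmod (a k) * r ^ k.
Proof.
  intros H. rewrite Cmod_mult, Cmod_pow.
  apply Rmult_le_compat_l; [apply Cmod_ge_0|].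
  apply pow_incr. split; [apply Cmod_ge_0|assumption].
Qed.

Lemma ev_terms a r z : Cmod z <= r -> summable a r ->
  ex_series (fun k => Rabs (Re (a k * z ^ k))) /\ ex_series (fun k => Rabs (Im (a k * z ^ k))).
Proof.
  intros Hz H.
  split; apply (ex_series_le (K := R_AbsRing) (V := R_CompleteNormedModule) _ _) with (2 := H);
    intros k; change norm with Rabs; rewrite Rabs_Rabsolu;
    (eapply Rle_trans; [|apply Cmod_term, Hz]); [apply re_le_Cmod|apply im_le_Cmod].
Qed.

Lemma psum_lim a r z : Cmod z <= r -> summable a r ->
  is_lim_seq (fun n => Cmod (psum a z n - ev a z)%C) 0.
Proof.
  intros Hz H. destruct (ev_terms a r z Hz H) as [H1 H2].
  apply is_lim_seq_le_le with (fun _ => 0)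
    (fun n => Rabs (Re (psum a z n) - Re (ev a z)) + Rabs (Im (psum a z n) - Im (ev a z))).
  - intros n; split; [apply Cmod_ge_0|].
    eapply Rle_trans; [apply Cmod_le_Re_Im|]. right. f_equal; f_equal; simpl; ring.
  - apply is_lim_seq_const.
  - replace 0 with (0 + 0) by ring. apply is_lim_seq_plus';
      apply (proj1 (is_lim_seq_abs_0 _)).
    + apply is_lim_seq_ext with (fun n => rsum (fun k => Re (a k * z ^ k)) n - Re (ev a z)).
      { intros n. unfold psum. now rewrite Re_csum. }
      replace 0 with (Re (ev a z) - Re (ev a z)) by ring.
      apply is_lim_seq_minus'; [|apply is_lim_seq_const].
      apply is_lim_seq_rsum. apply Series_correct, ex_series_Rabs, H1.
    + apply is_lim_seq_ext with (fun n => rsum (fun k => Im (a k * z ^ k)) n - Im (ev a z)).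
      { intros n. unfold psum. now rewrite Im_csum. }
      replace 0 with (Im (ev a z) - Im (ev a z)) by ring.
      apply is_lim_seq_minus'; [|apply is_lim_seq_const].
      apply is_lim_seq_rsum. apply Series_correct, ex_series_Rabs, H2.
Qed.

Lemma psum_diff a r z n m : Cmod z <= r -> (n <= m)%nat ->
  Cmod (psum a z m - psum a z n)%C <= partial_norm a r m - partial_norm a r n.
Proof.
  intros Hz. induction 1 as [|m _ IH].
  - replace (psum a z n - psum a z n)%C with (RtoC 0) by ring. rewrite Cmod_0; lra.
  - unfold psum, partial_norm in *. simpl.
    match goal with |- Cmod (?x + ?y - ?w)%C <= _ => replace (x + y - w)%C with ((x - w) + y)%C by ring end.
    eapply Rle_trans; [apply Cmod_triangle|].
    pose proof (Cmod_term a z r m Hz). lra.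
Qed.

Lemma psum_ev a r z n : Cmod z <= r -> summable a r ->
  Cmod (psum a z n - ev a z)%C <= remainder a r n.
Proof.
  intros Hz H.
  assert (Hr : 0 <= r) by (pose proof (Cmod_ge_0 z); lra).
  apply (is_lim_seq_le_loc (fun _ => Cmod (psum a z n - ev a z)%C)
    (fun m => remainder a r n + Cmod (psum a z m - ev a z)%C)
    (Cmod (psum a z n - ev a z)%C) (remainder a r n)).
  - exists n. intros m Hm.
    replace (psum a z n - ev a z)%C with ((psum a z n - psum a z m) + (psum a z m - ev a z))%C by ring.
    eapply Rle_trans; [apply Cmod_triangle|]. apply Rplus_le_compat_r.
    rewrite <- Cmod_opp. replace (- (psum a z n - psum a z m))%C with (psum a z m - psum a z n)%C by ring.
    eapply Rle_trans; [apply (psum_diff a r z n m Hz Hm)|].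
    unfold remainder. pose proof (partial_norm_le a r m Hr H). lra.
  - apply is_lim_seq_const.
  - rewrite <- (Rplus_0_r (remainder a r n)) at 1.
    apply is_lim_seq_plus'; [apply is_lim_seq_const|now apply psum_lim with r].
Qed.

Lemma Cmod_ev a r z : Cmod z <= r -> summable a r -> Cmod (ev a z) <= l1norm a r.
Proof.
  intros Hz H. pose proof (psum_ev a r z 0 Hz H) as H0. unfold psum, remainder, partial_norm in H0.
  simpl in H0. rewrite <- Cmod_opp. replace (- ev a z)%C with (0 - ev a z)%C by ring. lra.
Qed.

Lemma ev_unique a z (v : C) r (e : nat -> R) : Cmod z <= r -> summable a r ->
  is_lim_seq e 0 -> (forall n, Cmod (psum a z n - v)%C <= e n) -> ev a z = v.
Proof.
  intros Hz H He Hv.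
  assert (Cmod (ev a z - v)%C <= 0).
  { apply (is_lim_seq_le (fun _ => Cmod (ev a z - v)%C)
     (fun n => Cmod (psum a z n - ev a z)%C + e n) (Cmod (ev a z - v)%C) 0).
    - intros n. specialize (Hv n).
      replace (ev a z - v)%C with (- (psum a z n - ev a z) + (psum a z n - v))%C by ring.
      eapply Rle_trans; [apply Cmod_triangle|]. rewrite Cmod_opp. lra.
    - apply is_lim_seq_const.
    - replace 0 with (0 + 0) by ring.
      apply is_lim_seq_plus'; [now apply psum_lim with r|assumption]. }
  assert (Hc : Cmod (ev a z - v)%C = 0) by (pose proof (Cmod_ge_0 (ev a z - v)%C); lra).
  apply Cmod_eq_0 in Hc. now apply Ceq_minus.
Qed.

Lemma ev_ext a b z : (forall k, a k = b k) -> ev a z = ev b z.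
Proof.
  intros H. unfold ev. f_equal; apply Series_ext; intros k; now rewrite H.
Qed.

Lemma remainder_scal_lim c a r : summable a r -> is_lim_seq (fun n => c * remainder a r n) 0.
Proof.
  intros H. replace (Finite 0) with (Rbar_mult c 0) by (simpl; f_equal; ring).
  now apply is_lim_seq_scal_l, remainder_lim.
Qed.

Lemma summable_lincomb c a d b r : 0 <= r -> summable a r -> summable b r ->
  summable (fun k => c * a k + d * b k)%C r /\
  l1norm (fun k => c * a k + d * b k)%C r <= Cmod c * l1norm a r + Cmod d * l1norm b r.
Proof.
  intros Hr Ha Hb. apply summable_bounded; [assumption|]. intros n.
  apply Rle_trans with (Cmod c * partial_norm a r n + Cmod d * partial_norm b r n).
  - unfold partial_norm. rewrite <- !rsum_scal, <- rsum_plus. apply rsum_le. intros k _.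
    rewrite <- !Rmult_assoc, <- Rmult_plus_distr_r.
    apply Rmult_le_compat_r; [now apply pow_le|].
    eapply Rle_trans; [apply Cmod_triangle|]. rewrite !Cmod_mult. lra.
  - apply Rplus_le_compat; apply Rmult_le_compat_l; try apply Cmod_ge_0; now apply partial_norm_le.
Qed.

Lemma ev_lincomb c a d b r z : Cmod z <= r -> summable a r -> summable b r ->
  ev (fun k => c * a k + d * b k)%C z = (c * ev a z + d * ev b z)%C.
Proof.
  intros Hz Ha Hb. assert (Hr : 0 <= r) by (pose proof (Cmod_ge_0 z); lra).
  apply (ev_unique _ _ _ r (fun n => Cmod c * remainder a r n + Cmod d * remainder b r n) Hz).
  - now apply summable_lincomb.
  - replace 0 with (0 + 0) by ring.
    apply is_lim_seq_plus'; now apply remainder_scal_lim.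
  - intros n. replace (psum _ z n) with (c * psum a z n + d * psum b z n)%C.
    2:{ unfold psum. rewrite <- !csum_scal, <- csum_plus. apply csum_ext. intros; ring. }
    replace (_ - _)%C with (c * (psum a z n - ev a z) + d * (psum b z n - ev b z))%C by ring.
    eapply Rle_trans; [apply Cmod_triangle|]. rewrite !Cmod_mult.
    apply Rplus_le_compat; apply Rmult_le_compat_l; try apply Cmod_ge_0; now apply psum_ev.
Qed.

(** * Linear factors *)

Definition shift (a : nat -> C) : nat -> C := fun k => a (S k).

Definition lin (zeta : C) (b : nat -> C) : nat -> C :=
  fun k => match k with
           | O => (- zeta * b O)%C
           | S j => (b j - zeta * b (S j))%C
           end.

Lemma psum_lin zeta b z n :
  psum (lin zeta b) z (S n) = (z * psum b z n - zeta * psum b z (S n))%C.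
Proof.
  unfold psum. induction n as [|n IH].
  - simpl. ring.
  - change (csum (fun k => lin zeta b k * z ^ k)%C (S (S n))) with
      (csum (fun k => lin zeta b k * z ^ k)%C (S n) + lin zeta b (S n) * z ^ (S n))%C.
    rewrite IH. simpl. ring.
Qed.

Lemma partial_norm_lin zeta b r n : 0 <= r ->
  partial_norm (lin zeta b) r n <= (r + Cmod zeta) * partial_norm b r n.
Proof.
  intros Hr. destruct n as [|n]; [unfold partial_norm; simpl; lra|].
  assert (H : partial_norm (lin zeta b) r (S n)
     <= r * partial_norm b r n + Cmod zeta * partial_norm b r (S n)).
  { unfold partial_norm. induction n as [|n IH].
    - simpl. rewrite !Cmod_mult, Cmod_opp. lra.
    - change (rsum (fun k => Cmod (lin zeta b k) * r ^ k) (S (S n))) with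
      (rsum (fun k => Cmod (lin zeta b k) * r ^ k) (S n) + Cmod (lin zeta b (S n)) * r ^ (S n)).
      assert (Cmod (lin zeta b (S n)) * r ^ S n <=
              r * (Cmod (b n) * r ^ n) + Cmod zeta * (Cmod (b (S n)) * r ^ S n)).
      { replace (r * (Cmod (b n) * r ^ n)) with (Cmod (b n) * r ^ S n) by (simpl; ring).
        rewrite <- Rmult_assoc, <- Rmult_plus_distr_r.
        apply Rmult_le_compat_r; [now apply pow_le|]. simpl.
        unfold Cminus. eapply Rle_trans; [apply Cmod_triangle|].
        rewrite Cmod_opp, Cmod_mult. lra. }
      simpl in *. lra. }
  pose proof (partial_norm_incr b r n (S n) Hr (Nat.le_succ_diag_r n)). nra.
Qed.

Lemma summable_lin zeta b r : 0 <= r -> summable b r ->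
  summable (lin zeta b) r /\ l1norm (lin zeta b) r <= (r + Cmod zeta) * l1norm b r.
Proof.
  intros Hr H. apply summable_bounded; [assumption|]. intros n.
  eapply Rle_trans; [now apply partial_norm_lin|].
  apply Rmult_le_compat_l; [pose proof (Cmod_ge_0 zeta); lra|now apply partial_norm_le].
Qed.


Lemma ev_lin zeta b r z : Cmod z <= r -> summable b r ->
  ev (lin zeta b) z = ((z - zeta) * ev b z)%C.
Proof.
  intros Hz H. assert (Hr : 0 <= r) by (pose proof (Cmod_ge_0 z); lra).
  destruct (summable_lin zeta b r Hr H) as [Hl _].
  assert (Hn : forall n, Cmod (psum (lin zeta b) z (S n) - (z - zeta) * ev b z)%C
    <= (r + Cmod zeta) * remainder b r n).
  { intros n. rewrite psum_lin.
    replace (z * psum b z n - zeta * psum b z (S n) - (z - zeta) * ev b z)%C with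
      (z * (psum b z n - ev b z) + (- zeta) * (psum b z (S n) - ev b z))%C by ring.
    eapply Rle_trans; [apply Cmod_triangle|]. rewrite !Cmod_mult, Cmod_opp.
    pose proof (psum_ev b r z n Hz H). pose proof (psum_ev b r z (S n) Hz H).
    pose proof (remainder_decr b r n (S n) Hr (Nat.le_succ_diag_r n)).
    rewrite Rmult_plus_distr_r.
    apply Rplus_le_compat; apply Rmult_le_compat; try apply Cmod_ge_0; lra. }
  pose (C0 := Cmod ((z - zeta) * ev b z)%C).
  apply (ev_unique _ _ _ r
    (fun n => match n with O => C0 | S m => (r + Cmod zeta) * remainder b r m end) Hz Hl).
  - apply is_lim_seq_incr_1. now apply remainder_scal_lim.
  - intros [|n]; [|apply Hn]. unfold psum; simpl. rewrite <- Cmod_opp.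
    right. unfold C0. f_equal. ring.
Qed.

Lemma summable_shift a r : 0 < r -> summable a r ->
  summable (shift a) r /\ l1norm (shift a) r <= l1norm a r / r.
Proof.
  intros Hr H. apply summable_bounded; [lra|]. intros n.
  apply Rle_div_r; [assumption|].
  eapply Rle_trans; [|apply (partial_norm_le a r (S n)); [lra|assumption]].
  unfold partial_norm. rewrite rsum_S_l, Rmult_comm, <- rsum_scal.
  rewrite (rsum_ext (fun k => r * (Cmod (shift a k) * r ^ k))
    (fun k => Cmod (a (S k)) * r ^ S k)).
  - pose proof (term_nonneg a r 0 (Rlt_le _ _ Hr)). lra.
  - intros k _. unfold shift; simpl; ring.
Qed.

Lemma ev_shift a r z : 0 < r -> Cmod z <= r -> summable a r ->
  ev a z = (a O + z * ev (shift a) z)%C.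
Proof.
  intros Hr Hz H. destruct (summable_shift a r Hr H) as [Hs _].
  assert (Hn : forall n, psum a z (S n) = (a O + z * psum (shift a) z n)%C).
  { intros n. unfold psum. rewrite csum_S_l, <- csum_scal.
    f_equal; [simpl; ring|]. apply csum_ext. intros k _. unfold shift; simpl; ring. }
  apply (ev_unique _ _ _ r
    (fun n => match n with O => Cmod (a O + z * ev (shift a) z)%C
                      | S m => r * remainder (shift a) r m end) Hz H).
  - apply is_lim_seq_incr_1. now apply remainder_scal_lim.
  - intros [|n].
    + unfold psum; simpl. rewrite <- Cmod_opp. right. f_equal. ring.
    + rewrite Hn. replace (_ - _)%C with (z * (psum (shift a) z n - ev (shift a) z))%C by ring.
      rewrite Cmod_mult. apply Rmult_le_compat; try apply Cmod_ge_0; [assumption|].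
      now apply psum_ev.
Qed.

(** Horner's scheme for [(F(z) - F(zeta)) / (z - zeta)]: the [k]-th coefficient is
    the sum of [a_(k+1+j) zeta^j] over [j]. *)
Definition quot (a : nat -> C) (zeta : C) : nat -> C :=
  fun k => ev (fun j => a (j + S k)%nat) zeta.

Lemma summable_skip a r k : 0 < r -> summable a r ->
  summable (fun j => a (j + k)%nat) r /\ l1norm (fun j => a (j + k)%nat) r * r ^ k <= l1norm a r.
Proof.
  intros Hr H. induction k as [|k [IH1 IH2]].
  - assert (He : forall j, Cmod (a (j + 0)%nat) * r ^ j <= Cmod (a j) * r ^ j).
    { intros j. rewrite Nat.add_0_r. lra. }
    destruct (summable_le (fun j => a (j + 0)%nat) a r r) as [H1 H2]; try assumption; [lra|].
    split; [assumption|]. simpl. lra.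
  - destruct (summable_shift _ r Hr IH1) as [H1 H2].
    destruct (summable_le (fun j => a (j + S k)%nat) (shift (fun j => a (j + k)%nat)) r r) as [H3 H4].
    + lra.
    + assumption.
    + intros j. unfold shift. rewrite Nat.add_succ_r. simpl. lra.
    + split; [assumption|]. eapply Rle_trans; [|apply IH2].
      simpl. rewrite <- Rmult_assoc. apply Rmult_le_compat_r; [apply pow_le; lra|].
      apply Rle_div_r in H2; [|assumption].
      apply Rmult_le_compat_r with (r := r) in H4; lra.
Qed.

Lemma quot_step a r zeta k : 0 < r -> Cmod zeta <= r -> summable a r ->
  quot a zeta k = (a (S k) + zeta * quot a zeta (S k))%C.
Proof.
  intros Hr Hz H. destruct (summable_skip a r (S k) Hr H) as [H1 _].
  unfold quot. rewrite (ev_shift _ r zeta Hr Hz H1). f_equal. f_equal.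
  apply ev_ext. intros j. unfold shift. f_equal. lia.
Qed.

Lemma lin_quot a r zeta : 0 < r -> Cmod zeta <= r -> summable a r ->
  forall k, a k = (lin zeta (quot a zeta) k + match k with O => ev a zeta | _ => 0 end)%C.
Proof.
  intros Hr Hz H [|k]; simpl.
  - rewrite (ev_shift a r zeta Hr Hz H).
    replace (ev (shift a) zeta) with (quot a zeta 0); [ring|].
    unfold quot. apply ev_ext. intros j. unfold shift. f_equal. lia.
  - rewrite (quot_step a r zeta k Hr Hz H). ring.
Qed.

Lemma quot_bound a r zeta k : 0 < r -> Cmod zeta <= r -> summable a r ->
  Cmod (quot a zeta k) * r ^ k <= l1norm a r / r.
Proof.
  intros Hr Hz H. destruct (summable_skip a r (S k) Hr H) as [H1 H2].
  apply (proj1 (Rle_div_r _ _ _ Hr)). eapply Rle_trans; [|apply H2].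
  replace (Cmod (quot a zeta k) * r ^ k * r) with (Cmod (quot a zeta k) * r ^ S k) by (simpl; ring).
  apply Rmult_le_compat_r; [apply pow_le; lra|]. now apply Cmod_ev.
Qed.

(** The identity [b_k = a_(k+1) + zeta b_(k+1)] for the quotient [b] bounds a
    partial norm of [b] by [|a|_r / r] plus [|zeta| / r < 1] times itself, up to
    its last term; the crude bound of that last term costs the factor 2. *)
Lemma summable_quot a r zeta : Cmod zeta < r -> summable a r ->
  summable (quot a zeta) r /\ l1norm (quot a zeta) r <= 2 / (r - Cmod zeta) * l1norm a r.
Proof.
  intros Hz H. pose proof (Cmod_ge_0 zeta) as Hz0.
  assert (Hr : 0 < r) by lra. assert (Hz' : Cmod zeta <= r) by lra.
  pose proof (l1norm_nonneg a r (Rlt_le _ _ Hr) H) as Hn0.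
  apply summable_bounded; [lra|]. intros n.
  set (b := quot a zeta).
  assert (H1 : r * partial_norm b r n <= l1norm a r + Cmod zeta * partial_norm b r (S n)).
  { pose proof (partial_norm_le a r (S n) (Rlt_le _ _ Hr) H) as Ha.
    unfold partial_norm in Ha |- *. rewrite rsum_S_l in Ha |- *.
    assert (Hs : r * rsum (fun k => Cmod (b k) * r ^ k) n <=
      rsum (fun k => Cmod (a (S k)) * r ^ S k) n + Cmod zeta * rsum (fun k => Cmod (b (S k)) * r ^ S k) n).
    { rewrite <- !rsum_scal, <- rsum_plus. apply rsum_le. intros k _.
      replace (r * (Cmod (b k) * r ^ k)) with (Cmod (b k) * r ^ S k) by (simpl; ring).
      rewrite <- Rmult_assoc, <- Rmult_plus_distr_r.
      apply Rmult_le_compat_r; [apply pow_le; lra|].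
      unfold b. rewrite (quot_step a r zeta k Hr Hz' H) at 1.
      eapply Rle_trans; [apply Cmod_triangle|]. rewrite Cmod_mult. lra. }
    pose proof (term_nonneg a r 0 (Rlt_le _ _ Hr)).
    pose proof (term_nonneg b r 0 (Rlt_le _ _ Hr)). nra. }
  assert (H2 : Cmod (b n) * r ^ n <= l1norm a r / r) by now apply quot_bound.
  change (partial_norm b r (S n)) with (partial_norm b r n + Cmod (b n) * r ^ n) in H1.
  assert (H3 : Cmod zeta * (Cmod (b n) * r ^ n) <= l1norm a r).
  { apply Rle_trans with (Cmod zeta * (l1norm a r / r)); [now apply Rmult_le_compat_l|].
    replace (Cmod zeta * (l1norm a r / r)) with (l1norm a r * (Cmod zeta / r)) by (field; lra).
    rewrite <- (Rmult_1_r (l1norm a r)) at 2. apply Rmult_le_compat_l; [assumption|].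
    apply Rle_div_l; lra. }
  replace (2 / (r - Cmod zeta) * l1norm a r) with (2 * l1norm a r / (r - Cmod zeta)) by (field; lra).
  apply Rle_div_r; [lra|]. lra.
Qed.

(** * Averages over roots of unity *)

Definition cis (t : R) : C := (cos t, sin t).

Lemma cis_plus s t : cis (s + t) = (cis s * cis t)%C.
Proof. unfold cis, Cmult; simpl. rewrite cos_plus, sin_plus. f_equal; ring. Qed.

Lemma cis_0 : cis 0 = 1%C.
Proof. unfold cis. now rewrite cos_0, sin_0. Qed.

Lemma cis_opp t : cis (- t) = Cconj (cis t).
Proof. unfold cis, Cconj; simpl. now rewrite cos_neg, sin_neg. Qed.

Lemma Cmod_cis t : Cmod (cis t) = 1.
Proof.
  unfold Cmod, cis; simpl. transitivity (sqrt 1); [f_equal|apply sqrt_1].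
  pose proof (sin2_cos2 t) as H. unfold Rsqr in H. lra.
Qed.

Lemma cis_pow t n : (cis t ^ n)%C = cis (INR n * t).
Proof.
  induction n as [|n IH].
  - simpl. now rewrite Rmult_0_l, cis_0.
  - rewrite Cpow_S, IH, <- cis_plus, S_INR. f_equal. ring.
Qed.

Lemma cis_2PI_nat n : cis (2 * PI * INR n) = 1%C.
Proof.
  rewrite <- cis_0. unfold cis. f_equal.
  - rewrite <- (cos_period 0 n). f_equal. ring.
  - rewrite <- (sin_period 0 n). f_equal. ring.
Qed.

Lemma cis_2PI_Z (d : Z) : cis (2 * PI * IZR d) = 1%C.
Proof.
  destruct (Z_le_gt_dec 0 d) as [H|H].
  - rewrite <- (Z2Nat.id d H), <- INR_IZR_INZ. apply cis_2PI_nat.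
  - replace (2 * PI * IZR d) with (- (2 * PI * IZR (- d))) by (rewrite opp_IZR; ring).
    rewrite cis_opp. rewrite <- (Z2Nat.id (- d)) by lia.
    rewrite <- INR_IZR_INZ, cis_2PI_nat. unfold Cconj, RtoC; simpl. f_equal. ring.
Qed.

Lemma cis_neq_1 t : t <> 0 -> Rabs t < 2 * PI -> cis t <> 1%C.
Proof.
  intros H0 H He. apply (f_equal fst) in He. simpl in He.
  assert (Hs : sin (t / 2) = 0).
  { pose proof (cos_2a_sin (t / 2)) as Hc. replace (2 * (t / 2)) with t in Hc by field.
    rewrite He in Hc. nra. }
  apply Rabs_def2 in H.
  destruct (Rlt_le_dec 0 t) as [Ht|Ht].
  - pose proof (sin_gt_0 (t / 2)). lra.
  - pose proof (sin_gt_0 (- (t / 2))) as Hn. rewrite sin_neg in Hn. lra.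
Qed.

Lemma geometric_cis t m :
  ((cis t - 1) * csum (fun k => cis (INR k * t)) m)%C = (cis (INR m * t) - 1)%C.
Proof.
  induction m as [|m IH].
  - simpl. rewrite Rmult_0_l, cis_0. ring.
  - simpl csum. rewrite Cmult_plus_distr_l, IH, S_INR.
    rewrite Rmult_plus_distr_r, Rmult_1_l, cis_plus. ring.
Qed.

Definition root_angle (m k : nat) : R := 2 * PI * (INR k / INR m).

Lemma sum_roots (m : nat) (d : Z) : (0 < Z.abs d < Z.of_nat m)%Z ->
  csum (fun k => cis (IZR d * root_angle m k)) m = RtoC 0.
Proof.
  intros Hd. assert (Hm : 0 < INR m) by (apply lt_0_INR; lia).
  set (t := IZR d * (2 * PI / INR m)).
  rewrite (csum_ext _ (fun k => cis (INR k * t))).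
  2:{ intros k _. f_equal. unfold root_angle, t. field. lra. }
  pose proof (geometric_cis t m) as H.
  replace (INR m * t) with (2 * PI * IZR d) in H by (unfold t; field; lra).
  rewrite cis_2PI_Z in H.
  replace (1 - 1)%C with (RtoC 0) in H by ring.
  assert (Ht : cis t <> 1%C).
  { pose proof PI_RGT_0 as HPI.
    assert (Hq : 0 < 2 * PI / INR m) by (apply Rdiv_lt_0_compat; lra).
    apply cis_neq_1.
    - unfold t. apply Rmult_integral_contrapositive_currified; [|lra].
      apply not_0_IZR. lia.
    - unfold t. rewrite Rabs_mult, (Rabs_pos_eq (2 * PI / INR m)) by lra.
      rewrite <- abs_IZR. apply Rlt_le_trans with (INR m * (2 * PI / INR m)).
      + apply Rmult_lt_compat_r; [lra|]. rewrite INR_IZR_INZ. apply IZR_lt. lia.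
      + right. field. lra. }
  destruct (Ceq_dec (csum (fun k => cis (INR k * t)) m) 0) as [|Hn]; [assumption|].
  exfalso. apply (Cmult_neq_0 _ _ (Cminus_eq_contra _ _ Ht) Hn H).
Qed.

Lemma csum_1 m : csum (fun _ => RtoC 1) m = RtoC (INR m).
Proof.
  induction m as [|m IH]; [reflexivity|]. simpl csum. rewrite IH, S_INR, RtoC_plus. reflexivity.
Qed.

Definition circle (r : R) (m k : nat) : C := (RtoC r * cis (root_angle m k))%C.

Lemma Cmod_circle r m k : 0 <= r -> Cmod (circle r m k) = r.
Proof. intros H. unfold circle. rewrite Cmod_mult, Cmod_cis, Cmod_R, Rabs_pos_eq; lra. Qed.

Lemma circle_pow r m k n :
  (circle r m k ^ n)%C = (RtoC (r ^ n) * cis (INR n * root_angle m k))%C.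
Proof. unfold circle. now rewrite Cpow_mult_l, cis_pow, RtoC_pow. Qed.

Lemma fourier_psum a r m j n : (j < n <= m)%nat ->
  csum (fun k => (psum a (circle r m k) n * cis (- (INR j * root_angle m k)))%C) m
    = (RtoC (INR m) * (a j * RtoC (r ^ j)))%C.
Proof.
  intros Hj.
  rewrite (csum_ext _ (fun k => csum (fun i =>
    (a i * RtoC (r ^ i) * cis (IZR (Z.of_nat i - Z.of_nat j) * root_angle m k))%C) n)).
  2:{ intros k _. unfold psum. rewrite Cmult_comm, <- csum_scal. apply csum_ext. intros i _.
      rewrite circle_pow, minus_IZR, <- !INR_IZR_INZ.
      replace ((INR i - INR j) * root_angle m k) with (INR i * root_angle m k + - (INR j * root_angle m k)) by ring.
      rewrite cis_plus. ring. }
  rewrite csum_swap.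
  rewrite (csum_ext _ (fun i => if Nat.eqb i j
      then (RtoC (INR m) * (a j * RtoC (r ^ j)))%C else RtoC 0)).
  - assert (Hd : forall l, csum (fun i => if Nat.eqb i j
      then (RtoC (INR m) * (a j * RtoC (r ^ j)))%C else RtoC 0) l =
      if Nat.ltb j l then (RtoC (INR m) * (a j * RtoC (r ^ j)))%C else RtoC 0).
    { induction l as [|l IH]; [reflexivity|]. simpl csum. rewrite IH.
      destruct (Nat.ltb_spec j l), (Nat.eqb_spec l j), (Nat.ltb_spec j (S l)); try lia; ring. }
    rewrite Hd. destruct (Nat.ltb_spec j n); [reflexivity|lia].
  - intros i Hi. rewrite csum_scal. destruct (Nat.eqb_spec i j) as [->|Hne].
    + rewrite (csum_ext _ (fun _ => RtoC 1)), csum_1; [ring|].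
      intros k _. rewrite Z.sub_diag, Rmult_0_l. apply cis_0.
    + rewrite sum_roots by lia. ring.
Qed.

(** The conjugate only has frequencies [0, -1, .., -(n-1)], and none of them
    agrees with [j] modulo [m]. *)
Lemma fourier_conj_psum a r m j n : (1 <= j)%nat -> (n + j <= m)%nat ->
  csum (fun k => (Cconj (psum a (circle r m k) n) * cis (- (INR j * root_angle m k)))%C) m = RtoC 0.
Proof.
  intros Hj Hm.
  rewrite (csum_ext _ (fun k => csum (fun i =>
    (Cconj (a i) * RtoC (r ^ i) * cis (IZR (- (Z.of_nat i + Z.of_nat j)) * root_angle m k))%C) n)).
  2:{ intros k _. unfold psum.
      assert (Hc : forall l, Cconj (csum (fun i => (a i * circle r m k ^ i)%C) l) =
        csum (fun i => Cconj (a i * circle r m k ^ i)%C) l).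
      { induction l as [|l IH]; simpl; [unfold Cconj, RtoC; simpl; f_equal; ring|].
        now rewrite Cplus_conj, IH. }
      rewrite Hc, Cmult_comm, <- csum_scal. apply csum_ext. intros i _.
      rewrite circle_pow, opp_IZR, plus_IZR, <- !INR_IZR_INZ, !Cmult_conj.
      replace (- (INR i + INR j) * root_angle m k) with (- (INR i * root_angle m k) + - (INR j * root_angle m k)) by ring.
      rewrite cis_plus, (cis_opp (INR i * root_angle m k)).
      replace (Cconj (RtoC (r ^ i))) with (RtoC (r ^ i)); [ring|].
      unfold Cconj, RtoC; simpl; f_equal; ring. }
  rewrite csum_swap. rewrite (csum_ext _ (fun _ => RtoC 0)); [apply csum_0|].
  intros i Hi. rewrite csum_scal, sum_roots by lia. ring.
Qed.

Lemma Cmod_csum_le (u : nat -> C) (v : nat -> R) m :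
  (forall k, Cmod (u k) <= v k) -> Cmod (csum u m) <= rsum v m.
Proof.
  intros H. eapply Rle_trans; [apply Cmod_csum|]. apply rsum_le. intros; apply H.
Qed.

Lemma le_plus_remainder x y c a r : 0 <= r -> summable a r -> 0 <= c ->
  (exists n0, forall n, (n0 <= n)%nat -> x <= y + c * remainder a r n) -> x <= y.
Proof.
  intros Hr Ha Hc [n0 H]. apply Rnot_lt_le. intros Hlt.
  destruct (remainder_lt a r ((x - y) / (c + 1))) as [n1 Hn1]; try assumption.
  { apply Rdiv_lt_0_compat; lra. }
  pose proof (H (max n0 n1) (Nat.le_max_l _ _)) as H1.
  pose proof (Hn1 (max n0 n1) (Nat.le_max_r _ _)) as H2.
  pose proof (remainder_nonneg a r (max n0 n1) Hr Ha) as H3.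
  apply Rlt_div_r in H2; [|lra]. nra.
Qed.

(** Fourier inversion over the [m]-th roots of unity is exact for the partial sum
    of degree below [m], so it holds up to the remainder for the series itself. *)
Lemma cauchy_estimate a r A j : 0 <= r -> summable a r ->
  (forall z, Cmod z = r -> Cmod (ev a z) <= A) -> Cmod (a j) * r ^ j <= A.
Proof.
  intros Hr Ha HA. apply (le_plus_remainder _ _ 1 a r); try assumption; [lra|].
  exists (S j). intros m Hm.
  assert (Hm0 : 0 < INR m) by (apply lt_0_INR; lia).
  apply Rmult_le_reg_l with (INR m); [assumption|].
  replace (INR m * (Cmod (a j) * r ^ j)) with (Cmod (RtoC (INR m) * (a j * RtoC (r ^ j)))%C).
  2:{ rewrite !Cmod_mult, !Cmod_R, !Rabs_pos_eq; [reflexivity|now apply pow_le|lra]. }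
  rewrite <- (fourier_psum a r m j m) by lia.
  rewrite <- rsum_const. apply Cmod_csum_le. intros k.
  rewrite Cmod_mult, Cmod_cis, Rmult_1_r.
  pose proof (Cmod_circle r m k Hr) as Hk.
  replace (psum a (circle r m k) m) with
    (psum a (circle r m k) m - ev a (circle r m k) + ev a (circle r m k))%C by ring.
  eapply Rle_trans; [apply Cmod_triangle|].
  pose proof (HA _ Hk). pose proof (psum_ev a r (circle r m k) m (Req_le _ _ Hk) Ha). lra.
Qed.

(** Adding the conjugate of the series does not affect the Fourier coefficients of
    positive index, so they can be computed from the real part alone. *)
Lemma coef_le_mean_Re a r j n : 0 <= r -> summable a r -> (1 <= j <= n)%nat ->
  let m := (S n + S n)%nat in
  Cmod (a j) * r ^ j <=
    2 * (rsum (fun k => Rabs (Re (ev a (circle r m k)))) m / INR m) + 2 * remainder a r n.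
Proof.
  intros Hr Ha Hj m.
  assert (Hm0 : 0 < INR m) by (apply lt_0_INR; unfold m; lia).
  apply Rmult_le_reg_l with (INR m); [assumption|].
  replace (INR m * (Cmod (a j) * r ^ j)) with (Cmod (RtoC (INR m) * (a j * RtoC (r ^ j)))%C).
  2:{ rewrite !Cmod_mult, !Cmod_R, !Rabs_pos_eq; [reflexivity|now apply pow_le|lra]. }
  rewrite <- (fourier_psum a r m j (S n)) by (unfold m; lia).
  rewrite <- (Cplus_0_r (csum _ _)), <- (fourier_conj_psum a r m j (S n)) by (unfold m; lia).
  rewrite <- csum_plus.
  replace (INR m * _) with (rsum (fun k => 2 * Rabs (Re (ev a (circle r m k))) + 2 * remainder a r n) m).
  2:{ rewrite rsum_plus, rsum_scal, rsum_const. field. lra. }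
  apply Cmod_csum_le. intros k.
  rewrite <- Cmult_plus_distr_r, Cmod_mult, Cmod_cis, Rmult_1_r.
  pose proof (Cmod_circle r m k Hr) as Hk.
  replace (psum a (circle r m k) (S n) + Cconj (psum a (circle r m k) (S n)))%C
    with (RtoC (2 * Re (psum a (circle r m k) (S n)))).
  2:{ unfold RtoC, Cconj, Cplus, Re; simpl. f_equal; ring. }
  rewrite Cmod_R, Rabs_mult, (Rabs_pos_eq 2) by lra.
  rewrite <- Rmult_plus_distr_l. apply Rmult_le_compat_l; [lra|].
  pose proof (psum_ev a r (circle r m k) (S n) (Req_le _ _ Hk) Ha) as Ht.
  pose proof (re_le_Cmod (psum a (circle r m k) (S n) - ev a (circle r m k))%C) as Ht2.
  pose proof (remainder_decr a r n (S n) Hr (Nat.le_succ_diag_r n)) as Ht3.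
  replace (Re (psum a (circle r m k) (S n))) with (Re (ev a (circle r m k)) +
    Re (psum a (circle r m k) (S n) - ev a (circle r m k))%C) by (simpl; ring).
  eapply Rle_trans; [apply Rabs_triang|]. lra.
Qed.

Lemma mean_Re a r m : 0 <= r -> summable a r -> (1 <= m)%nat ->
  Rabs (rsum (fun k => Re (ev a (circle r m k))) m / INR m - Re (a O)) <= remainder a r m.
Proof.
  intros Hr Ha Hm. assert (Hm0 : 0 < INR m) by (apply lt_0_INR; lia).
  pose proof (fourier_psum a r m 0 m ltac:(lia)) as H.
  rewrite (csum_ext _ (fun k => psum a (circle r m k) m)) in H.
  2:{ intros k _. replace (- (INR 0 * root_angle m k)) with 0 by (simpl; ring).
      rewrite cis_0. ring. }
  apply (f_equal Re) in H. rewrite Re_csum in H.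
  replace (Re (RtoC (INR m) * (a 0%nat * RtoC (r ^ 0)))%C) with (INR m * Re (a O)) in H
    by (rewrite re_scal_l, re_scal_r; simpl; ring).
  replace (rsum _ m / INR m - Re (a 0%nat)) with
    (rsum (fun k => Re (ev a (circle r m k)) + - Re (psum a (circle r m k) m)) m / INR m).
  2:{ rewrite rsum_plus.
      rewrite (rsum_ext (fun k => - Re (psum a (circle r m k) m))
        (fun k => -1 * Re (psum a (circle r m k) m))) by (intros; ring).
      rewrite rsum_scal, H. field. lra. }
  unfold Rdiv. rewrite Rabs_mult, (Rabs_pos_eq (/ INR m)) by (left; now apply Rinv_0_lt_compat).
  apply Rle_div_l; [assumption|]. rewrite Rmult_comm, <- rsum_const.
  rewrite <- (Cmod_R (rsum _ m)).
  assert (HR : forall u l, RtoC (rsum u l) = csum (fun k => RtoC (u k)) l).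
  { intros u. induction l as [|l IH]; [reflexivity|]. simpl. now rewrite RtoC_plus, IH. }
  rewrite HR. apply Cmod_csum_le. intros k. rewrite Cmod_R.
  pose proof (Cmod_circle r m k Hr) as Hk.
  eapply Rle_trans; [|apply (psum_ev a r (circle r m k) m (Req_le _ _ Hk) Ha)].
  rewrite <- Rabs_Ropp. eapply Rle_trans; [|apply re_le_Cmod].
  right. f_equal. unfold Cminus. rewrite re_plus, re_opp. ring.
Qed.

(** * Cauchy products *)

(** The recursion peels the first coefficient of [a], so that the algebraic laws
    follow by induction with [a] generalized. *)
Fixpoint cprod (a b : nat -> C) (n : nat) : C :=
  match n with
  | O => (a O * b O)%C
  | S m => (a O * b (S m) + cprod (shift a) b m)%C
  end.

Lemma cprod_ext a a' b b' n : (forall k, (k <= n)%nat -> a k = a' k) ->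
  (forall k, (k <= n)%nat -> b k = b' k) -> cprod a b n = cprod a' b' n.
Proof.
  revert a a'. induction n as [|n IH]; intros a a' Ha Hb; simpl.
  - rewrite Ha, Hb by lia. reflexivity.
  - rewrite Ha, Hb by lia. f_equal. apply IH; intros k Hk; [apply Ha|apply Hb]; lia.
Qed.

Lemma cprod_plus_l a a' b n :
  cprod (fun k => a k + a' k)%C b n = (cprod a b n + cprod a' b n)%C.
Proof.
  revert a a'. induction n as [|n IH]; intros a a'; simpl; [ring|].
  change (shift (fun k => a k + a' k)%C) with (fun k => shift a k + shift a' k)%C.
  rewrite IH. ring.
Qed.

Lemma cprod_scal_l c a b n : cprod (fun k => c * a k)%C b n = (c * cprod a b n)%C.
Proof.
  revert a. induction n as [|n IH]; intros a; simpl; [ring|].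
  change (shift (fun k => c * a k)%C) with (fun k => c * shift a k)%C.
  rewrite IH. ring.
Qed.

Lemma cprod_assoc a b c n : cprod (cprod a b) c n = cprod a (cprod b c) n.
Proof.
  revert a. induction n as [|n IH]; intros a; simpl; [ring|].
  rewrite (cprod_ext (shift (cprod a b))
    (fun k => a O * shift b k + cprod (shift a) b k)%C c c) by reflexivity.
  rewrite cprod_plus_l, cprod_scal_l, IH. ring.
Qed.

Lemma cprod_S_r a b n : cprod a b (S n) = (cprod a (shift b) n + a (S n) * b O)%C.
Proof.
  revert a. induction n as [|n IH]; intros a; [reflexivity|].
  change (cprod a b (S (S n))) with (a O * b (S (S n)) + cprod (shift a) b (S n))%C.
  rewrite IH. simpl. unfold shift at 3 4. ring.
Qed.

Lemma cprod_comm a b n : cprod a b n = cprod b a n.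
Proof.
  revert a b. induction n as [|n IH]; intros a b; [simpl; ring|].
  rewrite cprod_S_r. simpl. rewrite IH. ring.
Qed.

Definition one : nat -> C := fun n => match n with O => RtoC 1 | _ => RtoC 0 end.

Lemma cprod_one_l a n : cprod one a n = a n.
Proof.
  destruct n as [|n]; simpl; [ring|].
  assert (H : forall m, cprod (shift one) a m = RtoC 0).
  { induction m as [|m IHm]; simpl; [unfold shift; simpl; ring|].
    rewrite (cprod_ext (shift (shift one)) (shift one) a a) by reflexivity.
    rewrite IHm. unfold shift; simpl; ring. }
  rewrite H. ring.
Qed.

Lemma cprod_one_r a n : cprod a one n = a n.
Proof. rewrite cprod_comm. apply cprod_one_l. Qed.

Lemma cprod_scaled (t : C) a b n :
  cprod (fun k => a k * t ^ k)%C (fun k => b k * t ^ k)%C n = (cprod a b n * t ^ n)%C.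
Proof.
  revert a. induction n as [|n IH]; intros a; simpl; [ring|].
  rewrite (cprod_ext (shift (fun k => a k * t ^ k)%C)
    (fun k => t * (shift a k * t ^ k))%C _ (fun k => b k * t ^ k)%C);
    [|intros; unfold shift; simpl; ring|reflexivity].
  rewrite cprod_scal_l, IH. ring.
Qed.

Lemma rsum_Cmod_cprod a b n :
  rsum (fun k => Cmod (cprod a b k)) n <=
  rsum (fun k => Cmod (a k)) n * rsum (fun k => Cmod (b k)) n.
Proof.
  revert a. induction n as [|n IH]; intros a; [simpl; lra|].
  specialize (IH (shift a)).
  assert (H1 : rsum (fun k => Cmod (cprod a b k)) (S n) <=
    Cmod (a O) * rsum (fun k => Cmod (b k)) (S n) + rsum (fun k => Cmod (cprod (shift a) b k)) n).
  { rewrite !rsum_S_l. rewrite Rmult_plus_distr_l, <- rsum_scal, Rplus_assoc, <- rsum_plus.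
    apply Rplus_le_compat; [simpl; rewrite Cmod_mult; lra|].
    apply rsum_le. intros k _. simpl. eapply Rle_trans; [apply Cmod_triangle|].
    rewrite Cmod_mult. lra. }
  eapply Rle_trans; [exact H1|].
  rewrite (rsum_S_l (fun k => Cmod (a k))), Rmult_plus_distr_r.
  apply Rplus_le_compat_l. eapply Rle_trans; [exact IH|].
  apply Rmult_le_compat_l; [apply rsum_nonneg; intros; apply Cmod_ge_0|].
  simpl. pose proof (Cmod_ge_0 (b n)). lra.
Qed.

Lemma partial_norm_scaled a r n : 0 <= r ->
  partial_norm a r n = rsum (fun k => Cmod (a k * RtoC r ^ k)%C) n.
Proof.
  intros Hr. apply rsum_ext. intros k _.
  rewrite Cmod_mult, Cmod_pow, Cmod_R, Rabs_pos_eq; [reflexivity|assumption].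
Qed.

Lemma partial_norm_cprod a b r n : 0 <= r ->
  partial_norm (cprod a b) r n <= partial_norm a r n * partial_norm b r n.
Proof.
  intros Hr. rewrite !partial_norm_scaled by assumption.
  eapply Rle_trans; [|apply rsum_Cmod_cprod].
  apply rsum_le. intros k _. rewrite cprod_scaled. lra.
Qed.

Lemma summable_cprod a b r : 0 <= r -> summable a r -> summable b r -> summable (cprod a b) r.
Proof.
  intros Hr Ha Hb. apply (summable_bounded _ _ (l1norm a r * l1norm b r)); [assumption|].
  intros n. eapply Rle_trans; [now apply partial_norm_cprod|].
  apply Rmult_le_compat; try apply partial_norm_nonneg; try apply partial_norm_le; assumption.
Qed.

Fixpoint rprod (a b : nat -> R) (n : nat) : R :=
  match n with
  | O => a O * b O
  | S m => a O * b (S m) + rprod (fun k => a (S k)) b m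
  end.

Lemma rprod_sum a b n : rprod a b n = sum_f_R0 (fun k => a k * b (n - k)%nat) n.
Proof.
  revert a. induction n as [|n IH]; intros a; [reflexivity|].
  rewrite decomp_sum by lia. simpl pred. rewrite Nat.sub_0_r.
  simpl rprod. rewrite IH. reflexivity.
Qed.

Lemma Re_cprod a b n : Re (cprod a b n) =
  rprod (fun k => Re (a k)) (fun k => Re (b k)) n - rprod (fun k => Im (a k)) (fun k => Im (b k)) n.
Proof.
  revert a. induction n as [|n IH]; intros a; simpl cprod; simpl rprod.
  - apply re_mult.
  - rewrite re_plus, re_mult, IH. unfold shift. ring.
Qed.

Lemma Im_cprod a b n : Im (cprod a b n) =
  rprod (fun k => Re (a k)) (fun k => Im (b k)) n + rprod (fun k => Im (a k)) (fun k => Re (b k)) n.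
Proof.
  revert a. induction n as [|n IH]; intros a; simpl cprod; simpl rprod.
  - apply im_mult.
  - rewrite im_plus, im_mult, IH. unfold shift. ring.
Qed.

Lemma is_series_rprod u v : ex_series (fun n => Rabs (u n)) -> ex_series (fun n => Rabs (v n)) ->
  is_series (rprod u v) (Series u * Series v).
Proof.
  intros Hu Hv. eapply is_series_ext; [intros n; symmetry; apply rprod_sum|].
  apply is_series_mult; try assumption; apply Series_correct, ex_series_Rabs; assumption.
Qed.

Lemma ev_cprod a b r z : Cmod z <= r -> summable a r -> summable b r ->
  ev (cprod a b) z = (ev a z * ev b z)%C.
Proof.
  intros Hz Ha Hb.
  destruct (ev_terms a r z Hz Ha) as [Ha1 Ha2]. destruct (ev_terms b r z Hz Hb) as [Hb1 Hb2].
  apply injective_projections.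
  all: change (fst (?u * ?v)%C) with (fst u * fst v - snd u * snd v).
  all: change (snd (?u * ?v)%C) with (fst u * snd v + snd u * fst v).
  all: unfold ev; cbn [fst snd]; apply is_series_unique.
  - eapply is_series_ext.
    { intros n. symmetry. rewrite <- cprod_scaled. apply Re_cprod. }
    apply (is_series_minus (K := R_AbsRing) (V := R_NormedModule)); now apply is_series_rprod.
  - eapply is_series_ext.
    { intros n. symmetry. rewrite <- cprod_scaled. apply Im_cprod. }
    apply (is_series_plus (K := R_AbsRing) (V := R_NormedModule)); now apply is_series_rprod.
Qed.

Lemma partial_norm_one r n : partial_norm one r n <= 1.
Proof.
  destruct n as [|n]; unfold partial_norm; [simpl; lra|].
  rewrite rsum_S_l, (rsum_ext _ (fun _ => 0)), rsum_const.
  - simpl. rewrite Cmod_1. lra.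
  - intros k _. simpl. rewrite Cmod_0. ring.
Qed.

Lemma summable_one r : 0 <= r -> summable one r.
Proof. intros Hr. apply (summable_bounded _ _ 1 Hr), partial_norm_one. Qed.

Lemma ev_one z : ev one z = RtoC 1.
Proof.
  pose proof (summable_one _ (Cmod_ge_0 z)) as Hs.
  apply (ev_unique _ _ _ (Cmod z) (fun n => match n with O => 1 | _ => 0 end)); try assumption.
  - lra.
  - apply is_lim_seq_incr_1. apply is_lim_seq_const.
  - intros [|n]; unfold psum.
    + simpl. rewrite <- Cmod_opp. replace (- (0 - 1))%C with (RtoC 1) by ring. rewrite Cmod_1. lra.
    + rewrite csum_S_l, (csum_ext (fun k => one (S k) * z ^ S k)%C (fun _ => RtoC 0)), csum_0.
      * simpl. match goal with |- Cmod ?x <= _ => replace x with (RtoC 0) by ring end.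
        rewrite Cmod_0. lra.
      * intros k _. simpl. ring.
Qed.

(** Written as a linear combination so that [ev_lincomb] applies. *)
Definition sub_const (a : nat -> C) (c : C) : nat -> C := fun k => (1 * a k + (- c) * one k)%C.

Lemma ev_sub_const a c r z : Cmod z <= r -> summable a r ->
  summable (sub_const a c) r /\ ev (sub_const a c) z = (ev a z - c)%C.
Proof.
  intros Hz Ha. assert (Hr : 0 <= r) by (pose proof (Cmod_ge_0 z); lra).
  pose proof (summable_one r Hr) as H1. split; [now apply summable_lincomb|].
  unfold sub_const. rewrite (ev_lincomb _ _ _ _ r), ev_one by assumption. ring.
Qed.

(** * The Euler operator *)

(** The operator [z d/dz]. It is preferred to the derivative because it keeps
    indices in place, which makes the Leibniz rule immediate by induction. *)
Definition euler (a : nat -> C) : nat -> C := fun k => (RtoC (INR k) * a k)%C.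

Lemma euler_cprod a b n :
  euler (cprod a b) n = (cprod (euler a) b n + cprod a (euler b) n)%C.
Proof.
  revert a. induction n as [|n IH]; intros a.
  - unfold euler; simpl. ring.
  - simpl cprod.
    rewrite (cprod_ext (shift (euler a)) (fun k => euler (shift a) k + shift a k)%C b b).
    + rewrite cprod_plus_l. specialize (IH (shift a)).
      unfold euler at 1. simpl cprod. unfold euler at 1 in IH.
      rewrite S_INR, RtoC_plus.
      transitivity (RtoC (INR n) * cprod (shift a) b n + cprod (shift a) b n
         + (RtoC (INR n) + 1) * (a O * b (S n)))%C; [ring|].
      rewrite IH.
      set (X := cprod (euler (shift a)) b n). set (Y := cprod (shift a) (euler b) n).
      unfold euler. rewrite S_INR, RtoC_plus. simpl INR. ring.
    + intros k _. unfold shift, euler. rewrite S_INR, RtoC_plus. ring.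
    + reflexivity.
Qed.

Lemma nat_pow_bound x k : 0 <= x < 1 -> INR k * x ^ k <= / (1 - x).
Proof.
  intros Hx. apply Rle_trans with (rsum (fun i => x ^ i) k); [|now apply rsum_geom_le].
  rewrite <- rsum_const. apply rsum_le. intros i Hi.
  replace k with (i + (k - i))%nat by lia. rewrite pow_add.
  rewrite <- (Rmult_1_r (x ^ i)) at 2. apply Rmult_le_compat_l; [apply pow_le; lra|].
  rewrite <- (pow1 (k - i)). apply pow_incr. lra.
Qed.

Lemma summable_euler a r s : 0 <= r < s -> summable a s -> summable (euler a) r.
Proof.
  intros Hr H. set (t := (r + s) / 2).
  assert (Ht : 0 < t < s) by (unfold t; lra).
  assert (Hx : 0 <= t / s < 1).
  { split; [apply Rdiv_le_0_compat; lra|]. apply Rlt_div_l; lra. }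
  assert (Hi : 0 <= / (1 - t / s)) by (left; apply Rinv_0_lt_compat; lra).
  assert (Hn := l1norm_nonneg a s ltac:(lra) H).
  apply (summable_of_bound (euler a) r t (l1norm a s * / (1 - t / s))).
  - unfold t; lra.
  - now apply Rmult_le_pos.
  - intros k. unfold euler. rewrite Cmod_mult, Cmod_R, Rabs_pos_eq by apply pos_INR.
    replace (INR k * Cmod (a k) * t ^ k) with ((Cmod (a k) * s ^ k) * (INR k * (t / s) ^ k)).
    + apply Rmult_le_compat.
      * apply term_nonneg; lra.
      * apply Rmult_le_pos; [apply pos_INR|now apply pow_le].
      * apply term_le_l1norm; [lra|assumption].
      * now apply nat_pow_bound.
    + unfold Rdiv. rewrite Rpow_mult_distr, pow_inv. field. apply pow_nonzero; lra.
Qed.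

(** * Inverting a zero-free power series *)

(** Each coefficient of the inverse depends on all the previous ones; row [n] of
    the table holds the correct coefficients up to index [n]. *)
Fixpoint inverse_table (a : nat -> C) (n : nat) : nat -> C :=
  match n with
  | O => fun _ => (/ a O)%C
  | S m => fun k => if Nat.eqb k (S m)
                    then (- / a O * cprod (shift a) (inverse_table a m) m)%C
                    else inverse_table a m k
  end.

Definition inverse (a : nat -> C) : nat -> C := fun n => inverse_table a n n.

Lemma inverse_table_stable a n k : (k <= n)%nat -> inverse_table a n k = inverse a k.
Proof.
  induction 1 as [|n Hn IH]; [reflexivity|].
  simpl. destruct (Nat.eqb_spec k (S n)); [lia|assumption].
Qed.

Lemma cprod_inverse (a : nat -> C) n : a O <> 0%C -> cprod a (inverse a) n = one n.
Proof.
  intros Ha. destruct n as [|n]; cbn [cprod one].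
  - exact (Cinv_r _ Ha).
  - unfold inverse at 1. cbn [inverse_table]. rewrite Nat.eqb_refl.
    rewrite (cprod_ext (shift a) (shift a) (inverse_table a n) (inverse a)).
    + field. assumption.
    + reflexivity.
    + intros. now apply inverse_table_stable.
Qed.

Lemma le_of_pow_le c B rho k : 0 < rho ->
  (forall s, 0 <= s < rho -> c * s ^ k <= B) -> c * rho ^ k <= B.
Proof.
  intros Hr H.
  set (s n := rho * (1 - / INR (S (S n)))).
  assert (Hs : is_lim_seq s rho).
  { unfold s. replace (Finite rho) with (Finite (rho * (1 - 0))) by (f_equal; ring).
    apply is_lim_seq_mult'; [apply is_lim_seq_const|].
    apply is_lim_seq_minus'; [apply is_lim_seq_const|].
    assert (Hi : is_lim_seq (fun n => INR (S (S n))) p_infty).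
    { apply (is_lim_seq_incr_1 (fun n => INR (S n))), (is_lim_seq_incr_1 INR), is_lim_seq_INR. }
    apply (is_lim_seq_inv _ _ Hi). discriminate. }
  apply (is_lim_seq_le (fun n => c * s n ^ k) (fun _ => B) (c * rho ^ k) B).
  - intros n. apply H. unfold s.
    assert (1 < INR (S (S n))) by (rewrite !S_INR; pose proof (pos_INR n); lra).
    assert (0 < / INR (S (S n)) < 1).
    { split; [apply Rinv_0_lt_compat; lra|]. rewrite <- Rinv_1. apply Rinv_lt_contravar; lra. }
    nra.
  - apply is_lim_seq_mult'; [apply is_lim_seq_const|].
    apply (is_lim_seq_continuous (fun x => x ^ k)); [|assumption].
    apply derivable_continuous_pt, derivable_pt_pow.
  - apply is_lim_seq_const.
Qed.

Lemma rsum_inv_sqr n : rsum (fun k => / (INR (S k) * INR (S k))) n <= 2.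
Proof.
  assert (H : forall m, rsum (fun k => / (INR (S k) * INR (S k))) (S m) <= 2 - / INR (S m)).
  { induction m as [|m IH]; [simpl; lra|].
    change (rsum (fun k => / (INR (S k) * INR (S k))) (S (S m))) with
      (rsum (fun k => / (INR (S k) * INR (S k))) (S m) + / (INR (S (S m)) * INR (S (S m)))).
    assert (0 < INR (S m)) by apply lt_0_INR, Nat.lt_0_succ.
    rewrite (S_INR (S m)). set (x := INR (S m)) in *.
    assert (/ ((x + 1) * (x + 1)) <= / x - / (x + 1)); [|lra].
    replace (/ x - / (x + 1)) with (/ (x * (x + 1))) by (field; lra).
    apply Rinv_le_contravar; nra. }
  destruct n as [|n]; [simpl; lra|]. specialize (H n).
  assert (0 < / INR (S n)) by (apply Rinv_0_lt_compat, lt_0_INR; lia). lra.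
Qed.

(** If the series [g] of [1 / G] converges absolutely at radius [rho], then on the
    circles of smaller radius [sigma] the values of [g], [z g'] and [z (z g')'] are
    bounded in terms of [G] and [mu] only: apply [z d/dz] twice to [G g = 1] and
    divide by [G]. Cauchy's estimate for the last one gives
    [k^2 |g_k| sigma^k <= B2]; then [sigma] tends to [rho], and the bound is
    summable over [k]. *)
Lemma inverse_a_priori G g s s' mu : 0 < s < s' -> summable G s' -> 0 < mu ->
  (forall z, Cmod z <= s -> mu <= Cmod (ev G z)) ->
  (forall n, cprod G g n = one n) ->
  exists B, 0 < B /\ forall rho, 0 <= rho <= s -> summable g rho -> l1norm g rho <= B.
Proof.
  intros Hs HG Hmu Hlow Hinv.
  set (M1 := l1norm (euler G) s). set (M2 := l1norm (euler (euler G)) s).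
  set (m := (s + s') / 2).
  assert (Hm : s < m < s') by (unfold m; lra).
  assert (HGm : summable (euler G) m) by (apply (summable_euler G m s'); [lra|assumption]).
  assert (HG0 : summable G s) by (apply (summable_radius G s s'); [lra|assumption]).
  assert (HG1 : summable (euler G) s) by (apply (summable_radius _ s m); [lra|assumption]).
  assert (HG2 : summable (euler (euler G)) s) by (apply (summable_euler _ s m); [lra|assumption]).
  assert (HM1 : 0 <= M1) by (apply l1norm_nonneg; [lra|assumption]).
  assert (HM2 : 0 <= M2) by (apply l1norm_nonneg; [lra|assumption]).
  set (B1 := / mu * (M1 * / mu)).
  set (B2 := / mu * (M2 * / mu + 2 * (M1 * B1))).
  assert (Himu : 0 < / mu) by now apply Rinv_0_lt_compat.
  assert (HB1 : 0 <= B1) by (unfold B1; apply Rmult_le_pos; [lra|apply Rmult_le_pos; lra]).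
  assert (HB2 : 0 <= B2).
  { unfold B2. apply Rmult_le_pos; [lra|].
    assert (0 <= M2 * / mu) by (apply Rmult_le_pos; lra).
    assert (0 <= M1 * B1) by (apply Rmult_le_pos; lra). lra. }
  (* z d/dz applied once and twice to G g = 1 *)
  assert (E1 : forall k, cprod (euler G) g k = (-1 * cprod G (euler g) k + 0 * G k)%C).
  { intros k. pose proof (euler_cprod G g k) as H.
    assert (H0 : euler (cprod G g) k = RtoC 0).
    { unfold euler. rewrite Hinv. destruct k; simpl; ring. }
    rewrite H0 in H.
    replace (cprod (euler G) g k) with (RtoC 0 - cprod G (euler g) k)%C; [ring|].
    rewrite H. ring. }
  assert (E2 : forall k, cprod (euler (euler G)) g k =
    (-1 * cprod G (euler (euler g)) k + -2 * cprod (euler G) (euler g) k)%C).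
  { intros k. pose proof (euler_cprod (euler G) g k) as H.
    pose proof (euler_cprod G (euler g) k) as H'.
    unfold euler at 1 in H. rewrite E1 in H. unfold euler at 1 in H'.
    transitivity (cprod (euler (euler G)) g k + cprod (euler G) (euler g) k - cprod (euler G) (euler g) k)%C;
      [ring|]. rewrite <- H.
    transitivity (- (INR k * cprod G (euler g) k) - cprod (euler G) (euler g) k)%C; [ring|].
    rewrite H'. ring. }
  assert (Hdecay : forall sigma rho k, 0 <= sigma < rho -> rho <= s -> summable g rho ->
     INR k * INR k * Cmod (g k) * sigma ^ k <= B2).
  { intros sigma rho k Hsig Hrho Hg.
    set (t := (sigma + rho) / 2). assert (Ht : sigma < t < rho) by (unfold t; lra).
    assert (Hg0 : summable g sigma) by (apply (summable_radius g sigma rho); [lra|assumption]).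
    assert (Hgt : summable (euler g) t) by (apply (summable_euler g t rho); [lra|assumption]).
    assert (Hg1 : summable (euler g) sigma) by (apply (summable_radius _ sigma t); [lra|assumption]).
    assert (Hg2 : summable (euler (euler g)) sigma) by (apply (summable_euler _ sigma t); [lra|assumption]).
    assert (K0 : summable G sigma) by (apply (summable_radius G sigma s); [lra|assumption]).
    assert (K1 : summable (euler G) sigma) by (apply (summable_radius _ sigma s); [lra|assumption]).
    assert (K2 : summable (euler (euler G)) sigma) by (apply (summable_radius _ sigma s); [lra|assumption]).
    replace (INR k * INR k * Cmod (g k)) with (Cmod (euler (euler g) k)).
    2:{ unfold euler. rewrite !Cmod_mult, !Cmod_R, Rabs_pos_eq by apply pos_INR. ring. }
    apply cauchy_estimate; [lra|assumption|]. intros z Hz.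
    assert (Hz' : Cmod z <= sigma) by lra.
    assert (Hlz : mu <= Cmod (ev G z)) by (apply Hlow; lra).
    assert (Hdiv : forall w, mu * Cmod w <= Cmod (ev G z) * Cmod w).
    { intros w. apply Rmult_le_compat_r; [apply Cmod_ge_0|assumption]. }
    assert (V0 : Cmod (ev g z) <= / mu).
    { apply Rmult_le_reg_l with mu; [assumption|]. rewrite Rinv_r by lra.
      eapply Rle_trans; [apply Hdiv|]. rewrite <- Cmod_mult, <- (ev_cprod G g sigma z) by assumption.
      rewrite (ev_ext _ one z Hinv), ev_one, Cmod_1. lra. }
    assert (W1 : Cmod (ev (euler G) z) <= M1) by (apply Cmod_ev; [lra|assumption]).
    assert (W2 : Cmod (ev (euler (euler G)) z) <= M2) by (apply Cmod_ev; [lra|assumption]).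
    assert (V1 : Cmod (ev (euler g) z) <= B1).
    { unfold B1. apply Rmult_le_reg_l with mu; [assumption|]. rewrite <- Rmult_assoc, Rinv_r, Rmult_1_l by lra.
      eapply Rle_trans; [apply Hdiv|]. rewrite <- Cmod_mult.
      pose proof (ev_ext _ _ z E1) as H.
      rewrite (ev_lincomb _ _ _ _ sigma), !(ev_cprod _ _ sigma) in H
        by (try assumption; apply summable_cprod; (assumption || lra)).
      replace (ev G z * ev (euler g) z)%C with (- (ev (euler G) z * ev g z))%C by (rewrite H; ring).
      rewrite Cmod_opp, Cmod_mult. apply Rmult_le_compat; (apply Cmod_ge_0 || assumption). }
    unfold B2. apply Rmult_le_reg_l with mu; [assumption|]. rewrite <- Rmult_assoc, Rinv_r, Rmult_1_l by lra.
    eapply Rle_trans; [apply Hdiv|]. rewrite <- Cmod_mult.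
    pose proof (ev_ext _ _ z E2) as H.
    rewrite (ev_lincomb _ _ _ _ sigma), !(ev_cprod _ _ sigma) in H
      by (try assumption; apply summable_cprod; (assumption || lra)).
    replace (ev G z * ev (euler (euler g)) z)%C with
      (- (ev (euler (euler G)) z * ev g z) + (- RtoC 2) * (ev (euler G) z * ev (euler g) z))%C by (rewrite H; ring).
    eapply Rle_trans; [apply Cmod_triangle|].
    rewrite !Cmod_mult, !Cmod_opp, !Cmod_mult, Cmod_R, (Rabs_pos_eq 2) by lra.
    apply Rplus_le_compat.
    - apply Rmult_le_compat; (apply Cmod_ge_0 || assumption).
    - apply Rmult_le_compat_l; [lra|]. apply Rmult_le_compat; (apply Cmod_ge_0 || assumption). }
  exists (Cmod (g O) + 2 * B2 + 1). split; [pose proof (Cmod_ge_0 (g O)); lra|].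
  intros rho Hrho Hg. apply Rle_trans with (Cmod (g O) + 2 * B2); [|lra].
  apply (summable_bounded g rho); [lra|]. intros n.
  apply Rle_trans with (partial_norm g rho (S n)); [apply partial_norm_incr; [lra|lia]|].
  unfold partial_norm. rewrite rsum_S_l. apply Rplus_le_compat; [simpl; lra|].
  apply Rle_trans with (rsum (fun k => B2 * / (INR (S k) * INR (S k))) n).
  - apply rsum_le. intros k _.
    assert (Hk : 0 < INR (S k)) by (apply lt_0_INR; lia).
    apply Rmult_le_reg_l with (INR (S k) * INR (S k)); [now apply Rmult_lt_0_compat|].
    replace (INR (S k) * INR (S k) * (B2 * / (INR (S k) * INR (S k)))) with B2 by (field; lra).
    rewrite <- Rmult_assoc. destruct (Rle_lt_or_eq_dec 0 rho (proj1 Hrho)) as [Hp|Hp].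
    + apply le_of_pow_le; [assumption|]. intros sg Hsg. apply Hdecay with rho; (assumption || lra).
    + rewrite <- Hp. simpl. lra.
  - rewrite rsum_scal. pose proof (rsum_inv_sqr n). rewrite (Rmult_comm 2).
    now apply Rmult_le_compat_l.
Qed.

(** For the series rescaled to the radii [r] and [r'] one has
    [g_r' = g_r - g_r (G_r' - G_r) g_r'] formally. Taking partial norms, which are
    finite whatever the convergence of [g_r'], absorbs the last term into the left
    side. *)
Lemma inverse_step G g B r r' : 0 <= r <= r' -> 0 < B ->
  (forall n, cprod G g n = one n) ->
  summable g r -> l1norm g r <= B ->
  (forall n, partial_norm G r' n - partial_norm G r n <= / (2 * B)) ->
  summable g r'.
Proof.
  intros Hr HB Hinv Hg HgB HG.
  apply (summable_bounded g r' (2 * B)); [lra|]. intros n.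
  pose (sc t a := fun k => (a k * RtoC t ^ k)%C).
  pose (d := fun k => (sc r' G k + -1 * sc r G k)%C).
  assert (Hone : forall t k, cprod (sc t G) (sc t g) k = one k).
  { intros t k. unfold sc. rewrite cprod_scaled, Hinv. destruct k; simpl; ring. }
  assert (E : forall k, sc r' g k = (sc r g k + -1 * cprod (sc r g) (cprod d (sc r' g)) k)%C).
  { intros k.
    assert (H : sc r g k = (sc r' g k + cprod (sc r g) (cprod d (sc r' g)) k)%C); [|rewrite H; ring].
    rewrite <- (cprod_one_r (sc r g)) at 1.
    rewrite (cprod_ext _ (sc r g) one (cprod (sc r' G) (sc r' g)));
      [|reflexivity|intros; symmetry; apply Hone].
    rewrite (cprod_ext (sc r g) (sc r g) (cprod (sc r' G) (sc r' g))
      (fun i => cprod (sc r G) (sc r' g) i + cprod d (sc r' g) i)%C); [|reflexivity|].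
    2:{ intros i _. unfold d.
        rewrite <- cprod_plus_l. apply cprod_ext; [intros; ring|reflexivity]. }
    rewrite cprod_comm, cprod_plus_l, !(cprod_comm _ (sc r g)). f_equal.
    rewrite <- cprod_assoc.
    rewrite (cprod_ext _ one (sc r' g) (sc r' g)); [apply cprod_one_l| |reflexivity].
    intros; rewrite cprod_comm; apply Hone. }
  set (N a := rsum (fun k => Cmod (a k)) n).
  assert (Hd : N d <= / (2 * B)).
  { eapply Rle_trans; [|apply (HG n)]. unfold partial_norm.
    replace (rsum _ n - rsum _ n) with (rsum (fun k => Cmod (G k) * r' ^ k + -1 * (Cmod (G k) * r ^ k)) n).
    2:{ rewrite rsum_plus, rsum_scal. ring. }
    apply rsum_le. intros k _. unfold d, sc.
    replace (G k * r' ^ k + -1 * (G k * r ^ k))%C with (G k * RtoC (r' ^ k - r ^ k))%C.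
    2:{ rewrite RtoC_minus, !RtoC_pow. ring. }
    rewrite Cmod_mult, Cmod_R, Rabs_pos_eq; [right; ring|].
    assert (r ^ k <= r' ^ k) by (apply pow_incr; lra). lra. }
  assert (Hx : N (sc r' g) <= B + B * (/ (2 * B) * N (sc r' g))).
  { assert (Hgr : N (sc r g) <= B).
    { unfold N, sc. rewrite <- partial_norm_scaled by lra.
      eapply Rle_trans; [apply partial_norm_le; [lra|assumption]|assumption]. }
    assert (HN : forall a, 0 <= N a) by (intros; apply rsum_nonneg; intros; apply Cmod_ge_0).
    apply Rle_trans with (N (sc r g) + N (cprod (sc r g) (cprod d (sc r' g)))).
    - unfold N. rewrite <- rsum_plus. apply rsum_le. intros k _. rewrite (E k) at 1.
      eapply Rle_trans; [apply Cmod_triangle|]. rewrite Cmod_mult.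
      replace (Cmod (-1)) with 1; [lra|]. rewrite Cmod_R, Rabs_left; lra.
    - apply Rplus_le_compat; [assumption|].
      eapply Rle_trans; [apply rsum_Cmod_cprod|]. apply Rmult_le_compat; try apply HN; [assumption|].
      eapply Rle_trans; [apply rsum_Cmod_cprod|]. apply Rmult_le_compat_r; [apply HN|assumption]. }
  rewrite partial_norm_scaled by lra. change (N (sc r' g) <= 2 * B).
  replace (B * (/ (2 * B) * N (sc r' g))) with (N (sc r' g) / 2) in Hx by (field; lra). lra.
Qed.

Lemma pow_diff_le x y s k : 0 <= x <= y -> y <= s ->
  s * (y ^ k - x ^ k) <= INR k * s ^ k * (y - x).
Proof.
  intros H Hs. induction k as [|k IH]; [simpl; lra|].
  rewrite S_INR. simpl.
  assert (H1 : x ^ k <= y ^ k) by now apply pow_incr.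
  assert (H2 : x ^ k <= s ^ k) by (apply pow_incr; lra).
  assert (H3 : y * (s * (y ^ k - x ^ k)) <= s * (INR k * s ^ k * (y - x))).
  { apply Rmult_le_compat; try assumption; [lra|]. apply Rmult_le_pos; lra. }
  assert (H4 : s * x ^ k * (y - x) <= s * s ^ k * (y - x)).
  { apply Rmult_le_compat_r; [lra|]. apply Rmult_le_compat_l; lra. }
  lra.
Qed.

(** Continuity method: absolute convergence at one radius gives the a priori bound
    there, and hence absolute convergence at a radius larger by a fixed step, so
    [s] is reached from 0 in finitely many steps. *)
Lemma summable_inverse G g s s' mu : 0 < s < s' -> summable G s' -> 0 < mu ->
  (forall z, Cmod z <= s -> mu <= Cmod (ev G z)) ->
  (forall n, cprod G g n = one n) -> summable g s.
Proof.
  intros Hs HG Hmu Hlow Hinv.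
  destruct (inverse_a_priori G g s s' mu Hs HG Hmu Hlow Hinv) as [B [HB Hap]].
  set (M := l1norm (euler G) s).
  assert (HG1 : summable (euler G) s) by (apply (summable_euler G s s'); [lra|assumption]).
  assert (HM : 0 <= M) by (apply l1norm_nonneg; [lra|assumption]).
  assert (Hstep : forall r r', 0 <= r <= r' -> r' <= s -> (r' - r) * (M * (2 * B)) <= s ->
    summable g r -> summable g r').
  { intros r r' Hr Hr's Hlen Hg. apply (inverse_step G g B r r'); try assumption.
    - apply Hap; [lra|assumption].
    - intros n. apply Rmult_le_reg_l with (2 * B * s); [apply Rmult_lt_0_compat; lra|].
      replace (2 * B * s * / (2 * B)) with s by (field; lra).
      eapply Rle_trans; [|apply Hlen].
      replace ((r' - r) * (M * (2 * B))) with (2 * B * (M * (r' - r))) by ring.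
      rewrite Rmult_assoc. apply Rmult_le_compat_l; [lra|].
      apply Rle_trans with ((r' - r) * partial_norm (euler G) s n).
      2:{ rewrite Rmult_comm. apply Rmult_le_compat_r; [lra|]. apply partial_norm_le; [lra|assumption]. }
      unfold partial_norm.
      replace (rsum (fun k => Cmod (G k) * r' ^ k) n - rsum (fun k => Cmod (G k) * r ^ k) n)
        with (rsum (fun k => Cmod (G k) * r' ^ k + -1 * (Cmod (G k) * r ^ k)) n)
        by (rewrite rsum_plus, rsum_scal; ring).
      rewrite <- !rsum_scal. apply rsum_le. intros k _. unfold euler.
      rewrite Cmod_mult, Cmod_R, Rabs_pos_eq by apply pos_INR.
      pose proof (pow_diff_le r r' s k Hr Hr's) as Hp.
      replace (s * (Cmod (G k) * r' ^ k + -1 * (Cmod (G k) * r ^ k))) with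
          (Cmod (G k) * (s * (r' ^ k - r ^ k))) by ring.
      replace ((r' - r) * (INR k * Cmod (G k) * s ^ k)) with
          (Cmod (G k) * (INR k * s ^ k * (r' - r))) by ring.
      apply Rmult_le_compat_l; [apply Cmod_ge_0|assumption]. }
  assert (HMB : 0 <= M * (2 * B)) by (apply Rmult_le_pos; lra).
  set (eps := s / (M * (2 * B) + 1)).
  assert (Heps : 0 < eps) by (apply Rdiv_lt_0_compat; lra).
  assert (Hlen : eps * (M * (2 * B)) <= s).
  { replace s with (eps * (M * (2 * B) + 1)) at 1 by (unfold eps; field; lra). nra. }
  assert (Hall : forall k, summable g (Rmin s (INR k * eps))).
  { induction k as [|k IH].
    - simpl. rewrite Rmult_0_l, Rmin_right by lra.
      apply (summable_bounded g 0 (Cmod (g O))); [lra|]. intros [|n].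
      + unfold partial_norm. simpl. apply Cmod_ge_0.
      + unfold partial_norm. rewrite rsum_S_l.
        rewrite (rsum_ext _ (fun _ => 0)), rsum_const by (intros; simpl; ring). simpl; lra.
    - assert (Hk := pos_INR k). assert (0 <= INR k * eps) by (apply Rmult_le_pos; lra).
      apply Hstep with (Rmin s (INR k * eps)); try assumption; rewrite S_INR.
      + split; [apply Rmin_glb; lra|]. apply Rle_min_compat_l. lra.
      + apply Rmin_l.
      + eapply Rle_trans; [|apply Hlen]. apply Rmult_le_compat_r; [assumption|].
        unfold Rmin; repeat destruct Rle_dec; lra. }
  destruct (archimed_cor1 (eps / s)) as [k [Hk Hk0]]; [apply Rdiv_lt_0_compat; lra|].
  specialize (Hall k). rewrite Rmin_left in Hall; [assumption|].
  assert (0 < INR k) by now apply lt_0_INR.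
  apply Rmult_lt_compat_l with (r := INR k * s) in Hk; [|apply Rmult_lt_0_compat; lra].
  replace (INR k * s * / INR k) with s in Hk by (field; lra).
  replace (INR k * s * (eps / s)) with (INR k * eps) in Hk by (field; lra). lra.
Qed.

(** * Logarithms of zero-free power series *)

(** Multiplying the derivative by [t] avoids a shift of indices and matches the
    operator [z d/dz]. *)
Lemma Rseries_derive (u : nat -> R) x t : 1 < x -> ex_series (fun k => Rabs (u k * x ^ k)) ->
  0 <= t <= 1 ->
  exists D, is_derive (fun y => Series (fun k => u k * y ^ k)) t D /\
    t * D = Series (fun k => INR k * u k * t ^ k).
Proof.
  intros Hx Hu Ht.
  assert (Hrad : Rbar_lt (Rabs t) (CV_radius u)).
  { apply Rbar_lt_le_trans with x; [rewrite Rabs_pos_eq; simpl; lra|].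
    destruct (Lub_Rbar_correct (CV_disk u)) as [Hub _]. exact (Hub x Hu). }
  exists (PSeries (PS_derive u) t). split; [exact (is_derive_PSeries u t Hrad)|].
  rewrite (Series_incr_1_aux (fun k => INR k * u k * t ^ k)) by (simpl; ring).
  unfold PSeries. rewrite <- Series_scal_l. apply Series_ext. intros k.
  unfold PS_derive. cbn [pow]. ring.
Qed.

Lemma ev_ray (a : nat -> C) z t : ev a (RtoC t * z)%C =
  (Series (fun k => Re (a k * z ^ k) * t ^ k), Series (fun k => Im (a k * z ^ k) * t ^ k)).
Proof.
  unfold ev. f_equal; apply Series_ext; intros k;
    rewrite Cpow_mult_l, <- RtoC_pow;
    replace (a k * (RtoC (t ^ k) * z ^ k))%C with ((a k * z ^ k) * RtoC (t ^ k))%C by ring;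
    [apply re_scal_r|apply im_scal_r].
Qed.

Lemma ev_ray_derive (a : nat -> C) s z t : Cmod z < s -> summable a s -> 0 <= t <= 1 ->
  exists D1 D2 : R, is_derive (fun y => Re (ev a (RtoC y * z)%C)) t D1 /\
    is_derive (fun y => Im (ev a (RtoC y * z)%C)) t D2 /\
    ev (euler a) (RtoC t * z)%C = (RtoC t * (D1, D2))%C.
Proof.
  intros Hz Ha Ht.
  assert (Hx : exists x, 1 < x /\ Cmod z * x <= s).
  { destruct (Rle_lt_or_eq_dec 0 (Cmod z) (Cmod_ge_0 z)) as [H|H].
    - exists (s / Cmod z). split; [apply Rlt_div_r; lra|right; field; lra].
    - exists 2. rewrite <- H in *. lra. }
  destruct Hx as [x [Hx Hxs]].
  destruct (ev_terms a s (RtoC x * z)%C) as [H1 H2]; [|assumption|].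
  { rewrite Cmod_mult, Cmod_R, Rabs_pos_eq; lra. }
  assert (HR : forall k, Re (a k * (RtoC x * z) ^ k) = Re (a k * z ^ k) * x ^ k).
  { intros k. rewrite Cpow_mult_l, <- RtoC_pow, <- re_scal_r. f_equal. ring. }
  assert (HI : forall k, Im (a k * (RtoC x * z) ^ k) = Im (a k * z ^ k) * x ^ k).
  { intros k. rewrite Cpow_mult_l, <- RtoC_pow, <- im_scal_r. f_equal. ring. }
  apply (ex_series_ext _ (fun k => Rabs (Re (a k * z ^ k) * x ^ k))) in H1;
    [|intros k; now rewrite HR].
  apply (ex_series_ext _ (fun k => Rabs (Im (a k * z ^ k) * x ^ k))) in H2;
    [|intros k; now rewrite HI].
  destruct (Rseries_derive _ x t Hx H1 Ht) as [D1 [HD1 E1]].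
  destruct (Rseries_derive _ x t Hx H2 Ht) as [D2 [HD2 E2]].
  exists D1, D2. split; [|split].
  - eapply is_derive_ext; [|exact HD1]. intros y. now rewrite ev_ray.
  - eapply is_derive_ext; [|exact HD2]. intros y. now rewrite ev_ray.
  - rewrite ev_ray. apply injective_projections.
    + transitivity (t * D1); [cbn [fst]|simpl; ring]. rewrite E1. apply Series_ext. intros k. unfold euler.
      rewrite <- Cmult_assoc, re_scal_l. ring.
    + transitivity (t * D2); [cbn [snd]|simpl; ring]. rewrite E2. apply Series_ext. intros k. unfold euler.
      rewrite <- Cmult_assoc, im_scal_l. ring.
Qed.

Lemma ev_at_0 a : ev a 0 = a O.
Proof.
  assert (E : forall k, (a (S k) * 0 ^ S k)%C = RtoC 0) by (intros k; rewrite Cpow_S; ring).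
  assert (HR : forall F : C -> R, F (RtoC 0) = 0 -> Series (fun k => F (a k * 0 ^ k)%C) = F (a O)).
  { intros F HF. apply is_series_unique, is_series_rsum, is_lim_seq_incr_1.
    apply is_lim_seq_ext with (fun _ => F (a O)); [|apply is_lim_seq_const].
    intros n. rewrite rsum_S_l, (rsum_ext _ (fun _ => 0)), rsum_const.
    - simpl Cpow. rewrite Cmult_1_r. ring.
    - intros k _. now rewrite E. }
  unfold ev. rewrite (HR Re), (HR Im) by reflexivity. now rewrite <- surjective_pairing.
Qed.

(** The solution [L] of [z L' = (z G') / G] whose value at the origin is [kappa], in
    place of [log |G(0)|]; a normalization of [G] is absorbed there. *)
Definition log_coef (kappa : R) (G : nat -> C) (n : nat) : C :=
  match n with
  | O => RtoC kappa
  | _ => (RtoC (/ INR n) * cprod (euler G) (inverse G) n)%C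
  end.

Lemma Cmod2_Re_Im w : Re w * Re w + Im w * Im w = Cmod w * Cmod w.
Proof. pose proof (Cmod2_alt w). simpl in H. lra. Qed.

Lemma is_derive_ln_sqr_norm (U V X : R -> R) t u v x :
  is_derive U t u -> is_derive V t v -> is_derive X t x -> 0 < U t * U t + V t * V t ->
  is_derive (fun y => ln (U y * U y + V y * V y) - 2 * X y) t
    (2 * (u * U t + v * V t) / (U t * U t + V t * V t) - 2 * x).
Proof.
  intros HU HV HX Hp. auto_derive.
  - repeat match goal with |- _ /\ _ => split end;
      first [now exists u|now exists v|now exists x|assumption|exact I].
  - replace (Derive (fun y => U y) t) with u by (symmetry; now apply is_derive_unique).
    replace (Derive (fun y => V y) t) with v by (symmetry; now apply is_derive_unique).
    replace (Derive (fun y => X y) t) with x by (symmetry; now apply is_derive_unique).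
    field. lra.
Qed.

(** Along the segment from 0 to [z], [log |G|^2] and [2 Re L] have the same
    derivative because [z L' G = z G']. *)
Lemma Re_log_coef kappa G s s' mu : 0 < s < s' -> summable G s' -> 0 < mu ->
  (forall z, Cmod z <= s -> mu <= Cmod (ev G z)) ->
  summable (log_coef kappa G) s /\
  forall z, Cmod z < s ->
    Re (ev (log_coef kappa G) z) = ln (Cmod (ev G z)) - ln (Cmod (G O)) + kappa.
Proof.
  intros Hs HG Hmu Hlow.
  set (L := log_coef kappa G). set (g := inverse G).
  assert (HG0 : G O <> RtoC 0).
  { intros H0. specialize (Hlow 0). rewrite ev_at_0, H0, Cmod_0 in Hlow. lra. }
  assert (Hinv : forall n, cprod G g n = one n) by (intros n; now apply cprod_inverse).
  assert (Hg : summable g s) by (apply (summable_inverse G g s s' mu); assumption).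
  assert (HGs : summable G s) by (apply (summable_radius G s s'); [lra|assumption]).
  assert (HeG : summable (euler G) s) by (apply (summable_euler G s s'); [lra|assumption]).
  assert (Hp : summable (cprod (euler G) g) s) by (apply summable_cprod; (lra || assumption)).
  assert (HL : summable L s).
  { apply (summable_bounded L s (Rabs kappa + l1norm (cprod (euler G) g) s)); [lra|].
    intros n. apply Rle_trans with (partial_norm L s (S n)); [apply partial_norm_incr; [lra|lia]|].
    unfold partial_norm. rewrite rsum_S_l. apply Rplus_le_compat.
    - simpl. rewrite Cmod_R. lra.
    - apply Rle_trans with (partial_norm (cprod (euler G) g) s (S n)); [|apply partial_norm_le; [lra|assumption]].
      unfold partial_norm. rewrite rsum_S_l.
      pose proof (term_nonneg (cprod (euler G) g) s 0 ltac:(lra)) as H0.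
      assert (H1 : forall k, Cmod (L (S k)) * s ^ S k <= Cmod (cprod (euler G) g (S k)) * s ^ S k).
      { intros k. apply Rmult_le_compat_r; [apply pow_le; lra|].
        change (L (S k)) with (RtoC (/ INR (S k)) * cprod (euler G) g (S k))%C.
        assert (1 <= INR (S k)) by (rewrite S_INR; pose proof (pos_INR k); lra).
        assert (0 < / INR (S k)) by (apply Rinv_0_lt_compat; lra).
        rewrite Cmod_mult, Cmod_R, Rabs_pos_eq by lra.
        rewrite <- (Rmult_1_l (Cmod (cprod _ _ _))) at 2.
        apply Rmult_le_compat_r; [apply Cmod_ge_0|].
        rewrite <- Rinv_1. apply Rinv_le_contravar; lra. }
      pose proof (rsum_le _ _ n (fun k _ => H1 k)). lra. }
  split; [assumption|]. intros z Hz.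
  assert (HeL : forall w, Cmod w <= s -> (ev (euler L) w * ev G w)%C = ev (euler G) w).
  { intros w Hw. rewrite (ev_ext (euler L) (cprod (euler G) g)).
    - rewrite (ev_cprod _ _ s) by assumption.
      transitivity (ev (euler G) w * (ev G w * ev g w))%C; [ring|].
      rewrite <- (ev_cprod G g s), (ev_ext _ one w Hinv), ev_one by assumption. ring.
    - intros [|k].
      + unfold euler; simpl. ring.
      + unfold euler at 1. change (L (S k)) with (RtoC (/ INR (S k)) * cprod (euler G) g (S k))%C.
        rewrite Cmult_assoc, <- RtoC_mult, Rinv_r by (apply not_0_INR; lia). ring. }
  set (phi := fun t : R => ln (Re (ev G (RtoC t * z)%C) * Re (ev G (RtoC t * z)%C) +
     Im (ev G (RtoC t * z)%C) * Im (ev G (RtoC t * z)%C)) - 2 * Re (ev L (RtoC t * z)%C)).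
  assert (Hray : forall t, 0 <= t <= 1 -> Cmod (RtoC t * z)%C <= s).
  { intros t Ht. rewrite Cmod_mult, Cmod_R, Rabs_pos_eq by lra.
    pose proof (Cmod_ge_0 z). nra. }
  assert (Hpos : forall t, 0 <= t <= 1 -> 0 < Re (ev G (RtoC t * z)%C) * Re (ev G (RtoC t * z)%C) +
     Im (ev G (RtoC t * z)%C) * Im (ev G (RtoC t * z)%C)).
  { intros t Ht. rewrite Cmod2_Re_Im. pose proof (Hlow _ (Hray t Ht)). nra. }
  assert (Hd : forall t, 0 <= t <= 1 -> exists D, is_derive phi t D /\ t * D = 0).
  { intros t Ht.
    destruct (ev_ray_derive G s z t Hz HGs Ht) as [u' [v' [Hu [Hv E]]]].
    destruct (ev_ray_derive L s z t Hz HL Ht) as [x' [y' [Hx [Hy E']]]].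
    pose proof (HeL _ (Hray t Ht)) as HE. rewrite E, E' in HE.
    pose proof (Hpos t Ht) as Hp0.
    eexists. split; [apply is_derive_ln_sqr_norm; eassumption|]. cbv beta.
    destruct (ev G (RtoC t * z)%C) as [U V]. cbn [Re Im fst snd] in *.
    injection HE as HE1 HE2.
    assert (HT : t * (u' * U + v' * V) = t * x' * (U * U + V * V)).
    { transitivity (U * (t * u' - 0 * v') + V * (t * v' + 0 * u')); [ring|].
      rewrite <- HE1, <- HE2. ring. }
    transitivity (2 * (t * (u' * U + v' * V)) / (U * U + V * V) - 2 * (t * x')); [field; lra|].
    rewrite HT. field. lra. }
  assert (Hphi : phi 1 = phi 0).
  { destruct (MVT_cor2 phi (Derive phi) 0 1 ltac:(lra)) as [c [He Hc]].
    - intros t Ht. apply is_derive_Reals.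
      destruct (Hd t Ht) as [D [HD _]]. apply Derive_correct. now exists D.
    - destruct (Hd c ltac:(lra)) as [D [HD HD0]]. rewrite (is_derive_unique _ _ _ HD) in He.
      assert (D = 0) by (apply Rmult_integral in HD0; destruct HD0; lra). subst D. lra. }
  unfold phi in Hphi. rewrite Cmult_1_l, Cmult_0_l, !ev_at_0, !Cmod2_Re_Im in Hphi.
  assert (H0 : 0 < Cmod (G O)) by now apply Cmod_gt_0.
  assert (Hz0 : 0 < Cmod (ev G z)) by (pose proof (Hlow z ltac:(lra)); lra).
  rewrite !ln_mult in Hphi by assumption.
  change (Re (L O)) with kappa in Hphi. lra.
Qed.

(** * Removing zeros *)

Definition root_prod (l : list C) (z : C) : C :=
  fold_right (fun zeta p => ((z - zeta) * p)%C) (RtoC 1) l.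

Lemma l1norm_ext a b r : (forall k, a k = b k) -> l1norm a r = l1norm b r.
Proof. intros H. apply Series_ext. intros k. now rewrite H. Qed.

Lemma euler_ext a b : (forall k, a k = b k) -> forall k, euler a k = euler b k.
Proof. intros H k. unfold euler. now rewrite H. Qed.

Lemma ev_euler_lin zeta b r z : Cmod z < r -> summable b r ->
  ev (euler (lin zeta b)) z = (z * ev b z + (z - zeta) * ev (euler b) z)%C.
Proof.
  intros Hz Hb. set (t := (Cmod z + r) / 2).
  assert (Ht : Cmod z < t < r) by (unfold t; lra). pose proof (Cmod_ge_0 z) as Hz0.
  assert (Hb1 : summable b t) by (apply (summable_radius b t r); [lra|assumption]).
  assert (Hb2 : summable (euler b) t) by (apply (summable_euler b t r); [lra|assumption]).
  assert (Hl1 := proj1 (summable_lin 0 b t ltac:(lra) Hb1)).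
  assert (Hl2 := proj1 (summable_lin zeta (euler b) t ltac:(lra) Hb2)).
  rewrite (ev_ext _ (fun k => 1 * lin 0 b k + 1 * lin zeta (euler b) k)%C).
  - rewrite (ev_lincomb _ _ _ _ t) by (lra || assumption).
    rewrite !(ev_lin _ _ t) by (lra || assumption). ring.
  - intros [|k]; unfold euler; cbn [lin]; [simpl INR; ring|].
    rewrite S_INR, RtoC_plus. ring.
Qed.

(** The last clause detects multiple roots: if a root of [a] in the list is still a
    root of the quotient [b], then the derivative of the series [a] vanishes there,
    or the root is 0. *)
Lemma divide_roots l : forall a r R0, 0 <= R0 < r -> summable a r -> NoDup l ->
  (forall zeta, In zeta l -> Cmod zeta <= R0 /\ ev a zeta = RtoC 0) ->
  exists b, summable b r /\
    l1norm b r <= (2 / (r - R0)) ^ length l * l1norm a r /\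
    (forall rho, 0 <= rho <= r -> l1norm a rho <= (rho + R0) ^ length l * l1norm b rho) /\
    (forall z, Cmod z <= r -> ev a z = (root_prod l z * ev b z)%C) /\
    (forall zeta, In zeta l -> ev b zeta = RtoC 0 -> ev (euler a) zeta = RtoC 0).
Proof.
  induction l as [|zeta l IH]; intros a r R0 HR Ha Hnd Hl.
  - exists a. split; [assumption|]. split; [simpl; lra|].
    split; [intros; simpl; lra|]. split; [intros; simpl; ring|]. intros zeta [].
  - destruct (Hl zeta (or_introl eq_refl)) as [Hz Hz0].
    inversion Hnd as [|? ? Hnin Hnd']; subst.
    pose proof (Cmod_ge_0 zeta) as Hzp.
    set (a1 := quot a zeta).
    destruct (summable_quot a r zeta ltac:(lra) Ha) as [Ha1 HN1]. fold a1 in Ha1, HN1.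
    assert (Ea : forall k, a k = lin zeta a1 k).
    { intros k. rewrite (lin_quot a r zeta ltac:(lra) ltac:(lra) Ha k). fold a1.
      rewrite Hz0. destruct k; ring. }
    assert (Hev : forall z, Cmod z <= r -> ev a z = ((z - zeta) * ev a1 z)%C).
    { intros z Hzr. rewrite (ev_ext _ _ z Ea). now apply ev_lin with r. }
    assert (Hl1 : forall w, In w l -> Cmod w <= R0 /\ ev a1 w = RtoC 0).
    { intros w Hw. destruct (Hl w (or_intror Hw)) as [Hw1 Hw2]. split; [assumption|].
      rewrite Hev in Hw2 by lra. destruct (Ceq_dec (ev a1 w) 0) as [|Hn]; [assumption|exfalso].
      apply (Cmult_neq_0 (w - zeta) (ev a1 w)); try assumption.
      apply Cminus_eq_contra. intros ->. contradiction. }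
    destruct (IH a1 r R0 HR Ha1 Hnd' Hl1) as [b [Hb [Hb1 [Hb2 [Hb3 Hb4]]]]].
    exists b. split; [assumption|]. split; [|split; [|split]].
    + eapply Rle_trans; [apply Hb1|]. simpl.
      rewrite Rmult_comm, (Rmult_comm (2 / (r - R0))), (Rmult_assoc (_ ^ _)), Rmult_comm.
      apply Rmult_le_compat_l.
      { apply pow_le. apply Rdiv_le_0_compat; lra. }
      eapply Rle_trans; [apply HN1|]. apply Rmult_le_compat_r; [apply l1norm_nonneg; (lra || assumption)|].
      apply Rmult_le_compat_l; [lra|]. apply Rinv_le_contravar; lra.
    + intros rho Hrho. rewrite (l1norm_ext _ _ _ Ea).
      destruct (summable_radius a1 rho r Hrho Ha1) as [Ha1r _].
      eapply Rle_trans; [apply summable_lin; [lra|assumption]|]. simpl. rewrite Rmult_assoc.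
      pose proof (l1norm_nonneg a1 rho ltac:(lra) Ha1r).
      apply Rmult_le_compat; try lra. now apply Hb2.
    + intros z Hzr. rewrite Hev, Hb3 by assumption. simpl. ring.
    + intros w Hw Hbw. rewrite (ev_ext _ _ w (euler_ext _ _ Ea)).
      destruct (Hl w Hw) as [Hwr _].
      rewrite (ev_euler_lin zeta a1 r w) by (lra || assumption).
      destruct Hw as [->|Hw].
      * rewrite (Hb3 w) by lra. rewrite Hbw. ring.
      * rewrite (proj2 (Hl1 w Hw)), (Hb4 w Hw Hbw). ring.
Qed.

(** Each root multiplies the norm at [r] by at most [2 / (r - R0)] when it is
    divided out, and the norm at [rho] by at most [rho + R0] when it is
    put back; the product of the two factors is at most 1/2. *)
Lemma root_count a l r rho R0 : 0 <= R0 < r -> 0 <= rho <= r -> 4 * (rho + R0) <= r - R0 ->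
  summable a r -> NoDup l ->
  (forall zeta, In zeta l -> Cmod zeta <= R0 /\ ev a zeta = RtoC 0) ->
  2 ^ length l * l1norm a rho <= l1norm a r.
Proof.
  intros HR Hrho H Ha Hnd Hl.
  destruct (divide_roots l a r R0 HR Ha Hnd Hl) as [b [Hb [Hb1 [Hb2 _]]]].
  destruct (summable_radius b rho r Hrho Hb) as [Hbr Hbn].
  pose proof (l1norm_nonneg a r ltac:(lra) Ha) as Hna.
  pose proof (l1norm_nonneg b rho ltac:(lra) Hbr) as Hnb.
  set (n := length l) in *.
  assert (H1 : l1norm a rho <= (rho + R0) ^ n * ((2 / (r - R0)) ^ n * l1norm a r)).
  { eapply Rle_trans; [now apply Hb2|]. apply Rmult_le_compat_l; [apply pow_le; lra|]. lra. }
  rewrite <- Rmult_assoc, <- Rpow_mult_distr in H1.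
  assert (H2 : 2 ^ n * ((rho + R0) * (2 / (r - R0))) ^ n <= 1).
  { rewrite <- Rpow_mult_distr, <- (pow1 n). apply pow_incr. split.
    - apply Rmult_le_pos; [lra|]. apply Rmult_le_pos; [lra|]. apply Rdiv_le_0_compat; lra.
    - replace (2 * ((rho + R0) * (2 / (r - R0)))) with (4 * (rho + R0) / (r - R0)) by (field; lra).
      apply Rle_div_l; lra. }
  apply Rle_trans with (2 ^ n * (((rho + R0) * (2 / (r - R0))) ^ n * l1norm a r)).
  - apply Rmult_le_compat_l; [apply pow_le; lra|assumption].
  - rewrite <- Rmult_assoc. nra.
Qed.

Lemma l1norm_pos a r k : 0 < r -> summable a r -> a k <> RtoC 0 -> 0 < l1norm a r.
Proof.
  intros Hr Ha Hk. eapply Rlt_le_trans; [|apply (term_le_l1norm a r k); [lra|assumption]].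
  apply Rmult_lt_0_compat; [now apply Cmod_gt_0|now apply pow_lt].
Qed.

Lemma finite_of_bounded (P : C -> Prop) (N : nat) :
  (forall l, NoDup l -> (forall z, In z l -> P z) -> (length l <= N)%nat) ->
  exists l, NoDup l /\ (forall z, In z l <-> P z).
Proof.
  intros HN.
  assert (H : forall n, (exists l, NoDup l /\ (forall z, In z l <-> P z)) \/
    (exists l, NoDup l /\ (forall z, In z l -> P z) /\ length l = n)).
  { induction n as [|n [H|[l [H1 [H2 H3]]]]].
    - right. exists nil. split; [constructor|]. split; [intros z []|reflexivity].
    - now left.
    - destruct (classic (exists z, P z /\ ~ In z l)) as [[z [Hz Hn]]|Hn].
      + right. exists (z :: l). split; [now constructor|]. split.
        * intros w [<-|Hw]; [assumption|now apply H2].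
        * simpl. now rewrite H3.
      + left. exists l. split; [assumption|]. intros z. split; [apply H2|].
        intros Hz. apply NNPP. intros Hni. apply Hn. now exists z. }
  destruct (H (S N)) as [Hf|[l [H1 [H2 H3]]]]; [assumption|].
  specialize (HN l H1 H2). lia.
Qed.

Lemma pow2_gt x : exists n, x < 2 ^ n.
Proof.
  destruct (INR_archimed 1 x) as [n Hn]; [lra|]. exists n.
  pose proof (poly n 1 ltac:(lra)) as H. replace (1 + 1) with 2 in H by ring. lra.
Qed.

Lemma finite_roots a r R0 : 0 <= R0 -> 5 * R0 < r -> summable a r -> (exists k, a k <> RtoC 0) ->
  exists l, forall z, In z l <-> Cmod z <= R0 /\ ev a z = RtoC 0.
Proof.
  intros HR Hr Ha [k Hk]. set (rho := (r - 5 * R0) / 4).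
  assert (Hrho : 0 < rho <= r) by (unfold rho; lra).
  assert (Har : summable a rho) by (apply (summable_radius a rho r); [lra|assumption]).
  pose proof (l1norm_pos a rho k ltac:(lra) Har Hk) as Hpos.
  destruct (pow2_gt (l1norm a r / l1norm a rho)) as [N HN].
  destruct (finite_of_bounded (fun z => Cmod z <= R0 /\ ev a z = RtoC 0) N) as [l [_ Hl]];
    [|now exists l].
  intros l Hnd Hl.
  pose proof (root_count a l r rho R0 ltac:(lra) ltac:(lra) ltac:(unfold rho; lra) Ha Hnd Hl) as H.
  apply Nat.nlt_ge. intros Hlt.
  apply Rlt_div_l in HN; [|assumption].
  assert (2 ^ N <= 2 ^ length l) by (apply Rle_pow; [lra|lia]). nra.
Qed.

(** * Lower bounds and the Borel-Caratheodory inequality *)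

Lemma ev_quot a r zeta z : Cmod zeta < r -> Cmod z <= r -> summable a r ->
  ev a z = ((z - zeta) * ev (quot a zeta) z + ev a zeta)%C.
Proof.
  intros H0 Hz Ha. pose proof (Cmod_ge_0 zeta).
  destruct (summable_quot a r zeta H0 Ha) as [Hq _].
  rewrite <- (ev_lin zeta _ r z Hz Hq).
  rewrite (ev_ext a (fun k => 1 * lin zeta (quot a zeta) k + ev a zeta * one k)%C).
  - rewrite (ev_lincomb _ _ _ _ r), ev_one; try assumption; [ring| |].
    + apply summable_lin; [lra|assumption].
    + apply summable_one. lra.
  - intros k. rewrite (lin_quot a r zeta) at 1 by (lra || assumption).
    destruct k; simpl one; ring.
Qed.

(** Factor out [w - w0] and bound the quotient by its norm. *)
Lemma ev_lipschitz a r w0 w : Cmod w0 < r -> Cmod w <= r -> summable a r ->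
  Cmod (ev a w - ev a w0)%C <= 2 / (r - Cmod w0) * l1norm a r * Cmod (w - w0)%C.
Proof.
  intros H0 Hw Ha. pose proof (Cmod_ge_0 w0).
  destruct (summable_quot a r w0 H0 Ha) as [Hq Hqn].
  rewrite (ev_quot a r w0 w H0 Hw Ha). replace ((w - w0) * ev (quot a w0) w + ev a w0 - ev a w0)%C with
    (ev (quot a w0) w * (w - w0))%C by ring.
  rewrite Cmod_mult. apply Rmult_le_compat_r; [apply Cmod_ge_0|].
  eapply Rle_trans; [apply (Cmod_ev _ r w Hw Hq)|]. exact Hqn.
Qed.

(** Compactness of a square that contains the disk of radius [s] and lies in the
    disk of radius [2 s]. *)
Lemma min_modulus a s r : 0 < s -> 2 * s < r -> summable a r ->
  (forall z, Cmod z <= 2 * s -> ev a z <> RtoC 0) ->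
  exists mu, 0 < mu /\ forall z, Cmod z <= s -> mu <= Cmod (ev a z).
Proof.
  intros Hs Hr Ha Hnz.
  set (K := 2 / (r - 2 * s) * l1norm a r).
  assert (HK : 0 <= K).
  { apply Rmult_le_pos; [apply Rdiv_le_0_compat; lra|apply l1norm_nonneg; (lra || assumption)]. }
  set (delta0 := fun u v => Cmod (ev a (u, v)) / (4 * (K + 1))).
  assert (Hd : forall x, {d : posreal | 0 < x -> pos d = x}).
  { intros x. destruct (Rlt_dec 0 x) as [H|H]; [exists (mkposreal x H); reflexivity|].
    exists (mkposreal 1 Rlt_0_1). intros; contradiction. }
  destruct (compactness_value_2d (-s) s (-s) s (fun u v => proj1_sig (Hd (delta0 u v)))) as [d Hcov].
  exists (2 * (K + 1) * d). pose proof (cond_pos d) as Hdp. split; [nra|].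
  intros [x y] Hz. apply Rnot_lt_le. intros Hlt.
  pose proof (re_le_Cmod (x, y)) as Hx. pose proof (im_le_Cmod (x, y)) as Hy.
  unfold Re, Im in Hx, Hy; cbn [fst snd] in Hx, Hy.
  apply (Hcov x y); [apply Rabs_le_between; lra|apply Rabs_le_between; lra|].
  intros [u [v [Hu [Hv [H1 [H2 H3]]]]]].
  assert (Hw0 : Cmod (u, v) <= 2 * s).
  { eapply Rle_trans; [apply Cmod_le_Re_Im|]. unfold Re, Im; cbn [fst snd].
    apply Rabs_le_between in Hu, Hv. lra. }
  assert (Hp : 0 < Cmod (ev a (u, v))) by now apply Cmod_gt_0, Hnz.
  assert (Hdelta : 0 < delta0 u v) by (apply Rdiv_lt_0_compat; lra).
  destruct (Hd (delta0 u v)) as [e He]. cbn [proj1_sig] in H1, H2, H3. rewrite (He Hdelta) in H1, H2, H3.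
  assert (Hdist : Cmod ((x, y) - (u, v))%C <= 2 * delta0 u v).
  { eapply Rle_trans; [apply Cmod_le_Re_Im|].
    replace (Re ((x, y) - (u, v))%C) with (x - u) by reflexivity.
    replace (Im ((x, y) - (u, v))%C) with (y - v) by reflexivity. lra. }
  pose proof (ev_lipschitz a r (u, v) (x, y) ltac:(lra) ltac:(lra) Ha) as HL.
  assert (HL' : Cmod (ev a (x, y) - ev a (u, v))%C <= K * (2 * delta0 u v)).
  { eapply Rle_trans; [apply HL|]. apply Rmult_le_compat; try assumption.
    - apply Rmult_le_pos; [apply Rdiv_le_0_compat; lra|apply l1norm_nonneg; (lra || assumption)].
    - apply Cmod_ge_0.
    - unfold K. apply Rmult_le_compat_r; [apply l1norm_nonneg; (lra || assumption)|].
      apply Rmult_le_compat_l; [lra|]. apply Rinv_le_contravar; lra. }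
  assert (Htri : Cmod (ev a (u, v)) <= Cmod (ev a (x, y)) + Cmod (ev a (x, y) - ev a (u, v))%C).
  { replace (ev a (u, v)) with (ev a (x, y) + - (ev a (x, y) - ev a (u, v)))%C at 1 by ring.
    eapply Rle_trans; [apply Cmod_triangle|]. rewrite Cmod_opp. lra. }
  assert (Hval : Cmod (ev a (u, v)) = 4 * (K + 1) * delta0 u v) by (unfold delta0; field; lra).
  nra.
Qed.

(** After subtracting [A] the real part is nonpositive, so the mean of its absolute
    value is minus its mean, which is its value at the centre. *)
Lemma borel_caratheodory a r A j : 0 <= r -> summable a r -> (1 <= j)%nat ->
  (forall z, Cmod z = r -> Re (ev a z) <= A) ->
  Cmod (a j) * r ^ j <= 2 * (A - Re (a O)).
Proof.
  intros Hr Ha Hj HA.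
  set (b := sub_const a (RtoC A)).
  assert (Hb : summable b r).
  { apply (ev_sub_const a (RtoC A) r 0); [rewrite Cmod_0|]; assumption. }
  assert (Hre : forall z, Cmod z = r -> Re (ev b z) <= 0).
  { intros z Hz. specialize (HA z Hz). unfold b.
    rewrite (proj2 (ev_sub_const a (RtoC A) r z ltac:(lra) Ha)).
    unfold Cminus. rewrite re_plus, re_opp, re_RtoC. lra. }
  assert (Hbj : b j = a j) by (unfold b, sub_const; destruct j; [lia|]; simpl; ring).
  assert (Hb0 : Re (b O) = Re (a O) - A) by (unfold b, sub_const, Re; simpl; ring).
  rewrite <- Hbj. replace (2 * (A - Re (a O))) with (2 * (- Re (b O))) by lra.
  apply (le_plus_remainder _ _ 4 b r); try assumption; [lra|].
  exists j. intros n Hn.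
  eapply Rle_trans; [apply (coef_le_mean_Re b r j n); [assumption|assumption|lia]|].
  set (m := (S n + S n)%nat). pose proof (mean_Re b r m Hr Hb ltac:(unfold m; lia)) as Hm.
  apply Rabs_le_between in Hm.
  rewrite (rsum_ext (fun k => Rabs _) (fun k => -1 * Re (ev b (circle r m k)))).
  2:{ intros k _. rewrite Rabs_left1; [ring|]. apply Hre. now apply Cmod_circle. }
  rewrite rsum_scal. pose proof (remainder_decr b r n m Hr ltac:(unfold m; lia)) as Hd.
  unfold Rdiv in *. rewrite Rmult_assoc. lra.
Qed.

(** * Values at a distance from finitely many points *)

Lemma lin_list_coef ws : (fold_right lin one ws) (length ws) = RtoC 1 /\
  forall k, (length ws < k)%nat -> (fold_right lin one ws) k = RtoC 0.
Proof.
  induction ws as [|w ws [IH1 IH2]].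
  - split; [reflexivity|]. intros [|k] Hk; [simpl in Hk; lia|reflexivity].
  - cbn [length fold_right]. split.
    + cbn [lin]. rewrite IH1, IH2 by lia. ring.
    + intros [|k] Hk; [lia|]. cbn [lin]. rewrite !IH2 by lia. ring.
Qed.

Lemma ev_lin_list ws r : 0 <= r -> summable (fold_right lin one ws) r /\
  forall z, Cmod z <= r -> ev (fold_right lin one ws) z = root_prod ws z.
Proof.
  intros Hr. induction ws as [|w ws [IH1 IH2]]; cbn [fold_right].
  - split; [now apply summable_one|]. intros; apply ev_one.
  - split; [now apply summable_lin|]. intros z Hz.
    rewrite (ev_lin w _ r z Hz IH1), IH2 by assumption. reflexivity.
Qed.

(** Otherwise Cauchy's estimate would bound the leading coefficient, which is 1, by
    [2^(-n)] with [n] the degree; in degree 0 the product is 1. *)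
Lemma monic_large_on_circle ws tau : 0 < tau ->
  exists c, Cmod c = tau /\ (tau / 2) ^ length ws <= Cmod (root_prod ws c).
Proof.
  intros Ht. apply NNPP. intros Hn.
  assert (H : forall c, Cmod c = tau -> Cmod (root_prod ws c) < (tau / 2) ^ length ws).
  { intros c Hc. apply Rnot_le_lt. intros Hle. apply Hn. now exists c. }
  destruct (ev_lin_list ws tau ltac:(lra)) as [Hs Hev].
  pose proof (cauchy_estimate _ tau ((tau / 2) ^ length ws) (length ws) ltac:(lra) Hs) as HC.
  rewrite (proj1 (lin_list_coef ws)), Cmod_1, Rmult_1_l in HC.
  assert (HC' : tau ^ length ws <= (tau / 2) ^ length ws).
  { apply HC. intros z Hz. rewrite Hev by lra. left. now apply H. }
  destruct ws as [|w ws].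
  - specialize (H (RtoC tau)). rewrite Cmod_R, Rabs_pos_eq in H by lra.
    specialize (H eq_refl). simpl in H. rewrite Cmod_1 in H. lra.
  - assert (HL : forall n, (tau / 2) ^ S n < tau ^ S n).
    { induction n as [|n IH]; [simpl; lra|].
      change ((tau / 2) * (tau / 2) ^ S n < tau * tau ^ S n).
      assert (0 <= (tau / 2) ^ S n) by (apply pow_le; lra). nra. }
    specialize (HL (length ws)). simpl length in HC'. lra.
Qed.

Fixpoint near_points (w : nat -> C) (rho : R) (m : nat) : list C :=
  match m with
  | O => nil
  | S n => if Rle_dec (Cmod (w n)) rho then w n :: near_points w rho n else near_points w rho n
  end.

(** A point [w k] of modulus above [4 S] is farther than [S] from [c] and contributes
    nothing to the left side. For the other points [|w k - c| <= 7 S], and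
    [Rmax 0 (- x) <= ln 7 - x] whenever [0 <= ln 7] and [x <= ln 7]. *)
Lemma sum_log_near_points w c S m : 0 < S -> Cmod c <= 3 * S ->
  root_prod (near_points w (4 * S) m) c <> RtoC 0 ->
  (forall k, (k < m)%nat -> w k <> c) /\
  rsum (fun k => Rmax 0 (- ln (Cmod (w k - c)%C / S))) m <=
    INR m * ln 7 - (ln (Cmod (root_prod (near_points w (4 * S) m) c))
       - INR (length (near_points w (4 * S) m)) * ln S).
Proof.
  intros HS Hc.
  assert (H7 : 0 < ln 7) by (rewrite <- ln_1; apply ln_increasing; lra).
  induction m as [|m IH]; intros Hne.
  - split; [intros; lia|]. simpl. rewrite Cmod_1, ln_1. lra.
  - cbn [near_points] in *. destruct (Rle_dec (Cmod (w m)) (4 * S)) as [Hn|Hn].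
    + cbn [root_prod fold_right] in Hne. fold (root_prod (near_points w (4 * S) m) c) in Hne.
      assert (Hne1 : root_prod (near_points w (4 * S) m) c <> RtoC 0).
      { intros H0. apply Hne. rewrite H0. ring. }
      assert (Hwc : (c - w m)%C <> RtoC 0).
      { intros H0. apply Hne. rewrite H0. ring. }
      destruct (IH Hne1) as [IH1 IH2]. split.
      * intros k Hk. destruct (Nat.eq_dec k m) as [->|Hkm]; [|apply IH1; lia].
        intros H0. apply Hwc. rewrite H0. ring.
      * cbn [rsum root_prod fold_right length]. fold (root_prod (near_points w (4 * S) m) c).
        rewrite Cmod_mult, ln_mult, !S_INR by (now apply Cmod_gt_0).
        assert (Hd : 0 < Cmod (c - w m)%C) by now apply Cmod_gt_0.
        assert (Hsym : Cmod (w m - c)%C = Cmod (c - w m)%C).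
        { rewrite <- Cmod_opp. f_equal. ring. }
        rewrite Hsym. unfold Rdiv. rewrite ln_mult, ln_Rinv by (try apply Rinv_0_lt_compat; lra).
        assert (Hup : ln (Cmod (c - w m)%C) <= ln 7 + ln S).
        { rewrite <- ln_mult by lra. apply ln_le; [assumption|].
          unfold Cminus. eapply Rle_trans; [apply Cmod_triangle|]. rewrite Cmod_opp. lra. }
        assert (Rmax 0 (- (ln (Cmod (c - w m)%C) + - ln S)) <= ln 7 - (ln (Cmod (c - w m)%C) - ln S)).
        { apply Rmax_lub; lra. }
        lra.
    + destruct (IH Hne) as [IH1 IH2].
      assert (Hfar : S <= Cmod (w m - c)%C).
      { assert (Cmod (w m) <= Cmod (w m - c)%C + Cmod c); [|lra].
        replace (w m) with ((w m - c) + c)%C at 1 by ring. apply Cmod_triangle. }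
      split.
      * intros k Hk. destruct (Nat.eq_dec k m) as [->|Hkm]; [|apply IH1; lia].
        intros H0. rewrite H0 in Hfar. replace (c - c)%C with (RtoC 0) in Hfar by ring.
        rewrite Cmod_0 in Hfar. lra.
      * cbn [rsum]. rewrite S_INR. rewrite Rmax_left; [lra|].
        assert (0 <= ln (Cmod (w m - c)%C / S)); [|lra].
        rewrite <- ln_1. apply ln_le; [lra|]. apply Rle_div_r; lra.
Qed.

Lemma avoid_finite (E : list R) a b : a < b -> exists x, a < x < b /\ ~ In x E.
Proof.
  intros Hab.
  assert (H : exists a' b', a <= a' < b' /\ b' <= b /\ forall x, a' < x < b' -> ~ In x E).
  { induction E as [|e E [a' [b' [H1 [H2 H3]]]]].
    - exists a, b. split; [lra|]. split; [lra|]. intros x _ [].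
    - destruct (Rle_lt_dec e ((a' + b') / 2)) as [He|He].
      + exists ((a' + b') / 2), b'. split; [lra|]. split; [lra|].
        intros x Hx [H0|H0]; [lra|]. apply (H3 x); [lra|assumption].
      + exists a', ((a' + b') / 2). split; [lra|]. split; [lra|].
        intros x Hx [H0|H0]; [lra|]. apply (H3 x); [lra|assumption]. }
  destruct H as [a' [b' [H1 [H2 H3]]]]. exists ((a' + b') / 2).
  split; [lra|]. apply H3. lra.
Qed.

(** The circle [|c| = tau] contains a point where the product of the distances to
    the nearby values is at least its expected size. The freedom in [tau] lets [c]
    avoid a finite set. *)
Lemma exists_remote_value (w : nat -> C) (E : list C) S m : 0 < S ->
  exists c, 2 * S < Cmod c < 3 * S /\ ~ In c E /\
    (forall k, (k < m)%nat -> w k <> c) /\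
    rsum (fun k => Rmax 0 (- ln (Cmod (w k - c)%C / S))) m <= INR m * ln 7.
Proof.
  intros HS. destruct (avoid_finite (map Cmod E) (2 * S) (3 * S)) as [tau [Ht HE]]; [lra|].
  set (ws := near_points w (4 * S) m).
  destruct (monic_large_on_circle ws tau) as [c [Hc Hp]]; [lra|].
  assert (HSp : S ^ length ws <= Cmod (root_prod ws c)).
  { eapply Rle_trans; [|apply Hp]. apply pow_incr. lra. }
  assert (HSp0 : 0 < S ^ length ws) by now apply pow_lt.
  assert (Hne : root_prod ws c <> RtoC 0) by (apply Cmod_gt_0; lra).
  destruct (sum_log_near_points w c S m HS ltac:(lra) Hne) as [H1 H2].
  exists c. split; [lra|]. split; [|split; [assumption|]].
  - intros Hin. apply HE. rewrite <- Hc. now apply in_map.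
  - fold ws in H2. apply ln_le in HSp; [|assumption]. rewrite ln_pow in HSp by assumption. lra.
Qed.

(** * The logarithmic majorant *)

Lemma root_prod_le_1 l z : (forall zeta, In zeta l -> Cmod (z - zeta)%C <= 1) ->
  Cmod (root_prod l z) <= 1.
Proof.
  induction l as [|w l IH]; intros H; simpl.
  - rewrite Cmod_1. lra.
  - rewrite Cmod_mult. rewrite <- (Rmult_1_l 1). apply Rmult_le_compat; try apply Cmod_ge_0.
    + apply H. now left.
    + apply IH. intros; apply H; now right.
Qed.

Lemma root_prod_ge l z d : 0 <= d -> (forall zeta, In zeta l -> d <= Cmod (z - zeta)%C) ->
  d ^ length l <= Cmod (root_prod l z).
Proof.
  intros Hd. induction l as [|w l IH]; intros H; simpl.
  - rewrite Cmod_1. lra.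
  - rewrite Cmod_mult. apply Rmult_le_compat; [assumption|now apply pow_le| |].
    + apply H. now left.
    + apply IH. intros; apply H; now right.
Qed.

Lemma pow_decr x n m : 0 <= x <= 1 -> (n <= m)%nat -> x ^ m <= x ^ n.
Proof.
  intros Hx. induction 1 as [|m _ IH]; [lra|]. simpl.
  assert (0 <= x ^ m) by (apply pow_le; lra). nra.
Qed.

Definition takes_at_most (p : nat) (a : nat -> C) (c : C) : Prop :=
  forall l, NoDup l -> (forall z, In z l -> Cmod z < 1 /\ ev a z = c) -> (length l <= p)%nat.

(** [L] is the logarithm of [b / S], where [b] is [f - c] with its zeros in [D_(1/8)]
    divided out. These zeros have modulus at least [d], which gives the bound of
    [exp kappa], and less than 1, which gives [0 <= kappa]. The product of the
    corresponding linear factors is at most 1 near the origin, hence the last clause.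
    The bound of the coefficients does not depend on [c]. *)
Lemma log_majorant a p d c : let S := l1norm a d in
  0 < d <= 1 / 8 -> summable a (3 / 4) -> takes_at_most p a c -> 0 < S ->
  2 * S < Cmod c < 3 * S ->
  (forall z, Cmod z <= 1 / 8 -> ev (euler a) z = RtoC 0 -> ev a z <> c) ->
  exists (kappa : R) (L : nat -> C), L O = RtoC kappa /\
    0 <= kappa /\ exp kappa <= 4 / d ^ p /\
    summable L (1 / 32) /\
    (forall j, (1 <= j)%nat ->
       Cmod (L j) * (1 / 64) ^ j <= 2 * ln (4 ^ p * (l1norm a (3 / 4) + 3 * S) / S)) /\
    (forall z, Cmod z <= 1 / 128 -> ev a z <> c ->
       ln (Cmod (ev a z - c)%C / S) <= Re (ev L z)).
Proof.
  intros S Hd Ha Hval HS Hc Hcrit.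
  set (f := sub_const a c).
  assert (H1 : summable one (3 / 4)) by (apply summable_one; lra).
  destruct (summable_lincomb 1 a (- c) one (3 / 4) ltac:(lra) Ha H1) as [Hf Hfn].
  fold f in Hf, Hfn.
  assert (Hone : l1norm one (3 / 4) <= 1).
  { apply (summable_bounded one (3 / 4) 1); [lra|apply partial_norm_one]. }
  assert (Hfev : forall z, Cmod z <= 3 / 4 -> ev f z = (ev a z - c)%C).
  { intros z Hz. now apply (ev_sub_const a c (3 / 4)). }
  assert (Hef : forall z, ev (euler f) z = ev (euler a) z).
  { intros z. apply ev_ext. intros k. unfold euler, f, sub_const. destruct k; simpl; ring. }
  destruct (finite_of_bounded (fun z => Cmod z <= 1 / 8 /\ ev f z = RtoC 0) p) as [l [Hnd Hl]].
  { intros l Hnd Hl. apply Hval; [assumption|]. intros z Hz. destruct (Hl z Hz) as [Hz1 Hz2].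
    rewrite Hfev in Hz2 by lra. split; [lra|]. now apply Ceq_minus. }
  assert (Hlen : (length l <= p)%nat).
  { apply Hval; [assumption|]. intros z Hz. destruct (proj1 (Hl z) Hz) as [Hz1 Hz2].
    rewrite Hfev in Hz2 by lra. split; [lra|]. now apply Ceq_minus. }
  destruct (divide_roots l f (3 / 4) (1 / 8) ltac:(lra) Hf Hnd (fun z Hz => proj1 (Hl z) Hz))
    as [b [Hb [Hbn [_ [Hbev Hbsimple]]]]].
  assert (Hbnz : forall z, Cmod z <= 2 * (1 / 32) -> ev b z <> RtoC 0).
  { intros z Hz H0.
    assert (Hfz : ev f z = RtoC 0) by (rewrite Hbev, H0 by lra; ring).
    assert (Hzl : In z l) by (apply Hl; split; [lra|assumption]).
    apply (Hcrit z); [lra| |].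
    - rewrite <- Hef. now apply Hbsimple.
    - rewrite Hfev in Hfz by lra. now apply Ceq_minus. }
  destruct (min_modulus b (1 / 32) (3 / 4) ltac:(lra) ltac:(lra) Hb Hbnz) as [mu [Hmu Hlow]].
  set (kappa := ln (Cmod (b O) / S)).
  destruct (Re_log_coef kappa b (1 / 32) (3 / 4) mu ltac:(lra) Hb Hmu Hlow) as [HL HLev].
  set (L := log_coef kappa b) in *.
  assert (Had : summable a d) by (apply (summable_radius a d (3 / 4)); [lra|assumption]).
  assert (Hsmall : forall z, Cmod z <= d -> Cmod (ev a z) <= S) by (intros; now apply Cmod_ev).
  assert (Ha0 : Cmod (a O) <= S).
  { rewrite <- ev_at_0. apply Hsmall. rewrite Cmod_0. lra. }
  assert (Hfar : forall zeta, In zeta l -> d <= Cmod (0 - zeta)%C).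
  { intros zeta Hz. destruct (proj1 (Hl zeta) Hz) as [Hz1 Hz2].
    rewrite <- Cmod_opp. replace (- (0 - zeta))%C with zeta by ring.
    apply Rnot_lt_le. intros Hlt. rewrite Hfev in Hz2 by lra. apply Ceq_minus in Hz2.
    pose proof (Hsmall zeta ltac:(lra)) as Hs. rewrite Hz2 in Hs. lra. }
  assert (Hprod0 : Cmod (a O - c)%C = Cmod (root_prod l 0) * Cmod (b O)).
  { rewrite <- Cmod_mult, <- (ev_at_0 b), <- Hbev, Hfev, ev_at_0 by (rewrite Cmod_0; lra). reflexivity. }
  assert (Hup : Cmod (a O - c)%C <= 4 * S).
  { unfold Cminus. eapply Rle_trans; [apply Cmod_triangle|]. rewrite Cmod_opp. lra. }
  assert (Hdn : S <= Cmod (a O - c)%C).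
  { assert (Cmod c <= Cmod (a O) + Cmod (a O - c)%C); [|lra].
    replace c with (a O + - (a O - c))%C at 1 by ring.
    eapply Rle_trans; [apply Cmod_triangle|]. rewrite Cmod_opp. lra. }
  assert (Hq1 : forall z, Cmod z <= 1 / 128 -> Cmod (root_prod l z) <= 1).
  { intros z Hz. apply root_prod_le_1. intros zeta Hzeta. apply Hl in Hzeta.
    unfold Cminus. eapply Rle_trans; [apply Cmod_triangle|]. rewrite Cmod_opp. lra. }
  assert (Hb0S : S <= Cmod (b O)).
  { pose proof (Hq1 0 ltac:(rewrite Cmod_0; lra)). pose proof (Cmod_ge_0 (b O)). nra. }
  assert (Hdp : 0 < d ^ p) by (apply pow_lt; lra).
  assert (Hb0up : Cmod (b O) / S <= 4 / d ^ p).
  { apply Rle_div_l; [assumption|]. replace (4 / d ^ p * S) with (4 * S / d ^ p) by (field; lra).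
    apply (proj1 (Rle_div_r _ _ _ Hdp)). eapply Rle_trans; [|apply Hup].
    rewrite Hprod0, Rmult_comm. apply Rmult_le_compat_r; [apply Cmod_ge_0|].
    eapply Rle_trans; [|apply (root_prod_ge l 0 d); [lra|assumption]].
    apply pow_decr; [lra|assumption]. }
  assert (Hratio : 1 <= Cmod (b O) / S) by (apply Rle_div_r; lra).
  assert (Hkappa : 0 <= kappa).
  { unfold kappa. rewrite <- ln_1. apply ln_le; lra. }
  assert (HRe : forall z, Cmod z < 1 / 32 -> Re (ev L z) = ln (Cmod (ev b z) / S)).
  { intros z Hz. rewrite (HLev z Hz). unfold kappa.
    assert (0 < Cmod (ev b z)) by (apply Cmod_gt_0, Hbnz; lra).
    rewrite !ln_div by lra. ring. }
  exists kappa, L. split; [reflexivity|]. split; [assumption|]. split.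
  { unfold kappa. rewrite exp_ln; lra. }
  split; [assumption|]. split.
  - intros j Hj.
    assert (HL' : summable L (1 / 64)) by (apply (summable_radius L (1 / 64) (1 / 32)); [lra|assumption]).
    eapply Rle_trans; [apply (borel_caratheodory L (1 / 64)
      (ln (4 ^ p * (l1norm a (3 / 4) + 3 * S) / S)) j); try assumption; [lra|]|].
    + intros z Hz. rewrite HRe by lra.
      assert (0 < Cmod (ev b z)) by (apply Cmod_gt_0, Hbnz; lra).
      apply ln_le; [now apply Rdiv_lt_0_compat|].
      apply Rmult_le_compat_r; [left; now apply Rinv_0_lt_compat|].
      eapply Rle_trans; [apply (Cmod_ev b (3 / 4)); [lra|assumption]|].
      eapply Rle_trans; [apply Hbn|].
      pose proof (l1norm_nonneg f (3 / 4) ltac:(lra) Hf).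
      apply Rmult_le_compat; try assumption.
      * apply pow_le. lra.
      * apply Rle_trans with (4 ^ length l); [apply pow_incr; lra|]. apply Rle_pow; [lra|assumption].
      * eapply Rle_trans; [apply Hfn|]. rewrite Cmod_1, Cmod_opp, Rmult_1_l.
        apply Rplus_le_compat_l. pose proof (Cmod_ge_0 c).
        pose proof (l1norm_nonneg one (3 / 4) ltac:(lra) H1). nra.
    + change (Re (L O)) with kappa. lra.
  - intros z Hz Hzc. rewrite HRe by lra.
    assert (H0 : 0 < Cmod (ev a z - c)%C) by (apply Cmod_gt_0; now apply Cminus_eq_contra).
    apply ln_le; [now apply Rdiv_lt_0_compat|].
    apply Rmult_le_compat_r; [left; now apply Rinv_0_lt_compat|].
    rewrite <- Hfev, Hbev, Cmod_mult by lra.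
    pose proof (Hq1 z Hz). pose proof (Cmod_ge_0 (ev b z)). nra.
Qed.

(** * Domination by the first coefficients *)

Lemma remainder_geom a r n M x : 0 <= r -> 0 <= x < 1 -> 0 <= M -> summable a r ->
  (forall j, (n <= j)%nat -> Cmod (a j) * r ^ j <= M * x ^ j) ->
  remainder a r n <= M * x ^ n / (1 - x).
Proof.
  intros Hr Hx HM Ha H.
  assert (Hp : forall m, partial_norm a r (n + m) <= partial_norm a r n + M * x ^ n / (1 - x)).
  { intros m.
    assert (E : partial_norm a r (n + m) =
      partial_norm a r n + rsum (fun k => Cmod (a (n + k)%nat) * r ^ (n + k)) m).
    { induction m as [|m IH]; [rewrite Nat.add_0_r; simpl; ring|].
      rewrite Nat.add_succ_r. unfold partial_norm in *. cbn [rsum]. rewrite IH. ring. }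
    rewrite E. apply Rplus_le_compat_l.
    apply Rle_trans with (rsum (fun k => M * x ^ n * x ^ k) m).
    - apply rsum_le. intros k _. rewrite Rmult_assoc, <- pow_add. apply H. lia.
    - rewrite rsum_scal. apply Rmult_le_compat_l; [apply Rmult_le_pos; [lra|now apply pow_le]|].
      now apply rsum_geom_le. }
  assert (Hb : l1norm a r <= partial_norm a r n + M * x ^ n / (1 - x)).
  { apply (summable_bounded a r); [assumption|]. intros m.
    apply Rle_trans with (partial_norm a r (n + m)); [apply partial_norm_incr; [assumption|lia]|apply Hp]. }
  unfold remainder. lra.
Qed.

Lemma pow_half_small B eps : 0 <= B -> 0 < eps -> exists n, (1 <= n)%nat /\ B * (1 / 2) ^ n <= eps.
Proof.
  intros HB He. destruct (pow2_gt (B / eps)) as [n Hn]. exists (S n). split; [lia|].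
  assert (H2 : 0 < 2 ^ n) by (apply pow_lt; lra).
  apply Rlt_div_l in Hn; [|assumption].
  assert (H : (1 / 2) ^ S n <= / 2 ^ n).
  { simpl. unfold Rdiv. rewrite Rmult_1_l, pow_inv.
    assert (0 < / 2 ^ n) by now apply Rinv_0_lt_compat. lra. }
  apply Rle_trans with (B * / 2 ^ n); [now apply Rmult_le_compat_l|].
  apply Rle_div_l; [assumption|]. lra.
Qed.

(** A discrete Harnack inequality. Since [|Re L| <= Re L + 2 q] on the samples, the
    mean of [|Re L|] is at most [kappa + 2 M] up to sampling error. Twice this bounds
    [|L_j| r^j], and at radius [r / 2] the factors [2^(-j)] sum to at most 1. The
    coefficients beyond [n], for which sampling gives no information, are left in the
    remainder. *)
Lemma Re_le_of_negative_part L kappa M x r n q : let m := (S n + S n)%nat in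
  0 < r -> summable L r -> L O = RtoC kappa -> 0 <= kappa ->
  (forall k, (k < m)%nat -> - x k <= q k /\ 0 <= q k /\ x k <= Re (ev L (circle r m k))) ->
  rsum q m <= INR m * M ->
  forall z, Cmod z <= r / 2 -> Re (ev L z) <= 3 * kappa + 4 * M + 5 * remainder L r n.
Proof.
  intros m Hr HL HL0 Hk Hx Hq z Hz.
  assert (Hm0 : 0 < INR m) by (apply lt_0_INR; unfold m; lia).
  set (e := remainder L r n).
  assert (He : 0 <= e) by (apply remainder_nonneg; [lra|assumption]).
  assert (HM : 0 <= M).
  { apply Rmult_le_reg_l with (INR m); [assumption|]. rewrite Rmult_0_r.
    eapply Rle_trans; [|apply Hq]. apply rsum_nonneg. intros k Hkm. apply (Hx k Hkm). }
  set (Lam := 2 * (kappa + e + 2 * M) + 2 * e).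
  assert (Hcoef : forall j, (1 <= j <= n)%nat -> Cmod (L j) * r ^ j <= Lam).
  { intros j Hj. eapply Rle_trans; [apply (coef_le_mean_Re L r j n); [lra|assumption|assumption]|].
    fold m. fold e. unfold Lam. apply Rplus_le_compat_r. apply Rmult_le_compat_l; [lra|].
    apply Rle_div_l; [assumption|].
    pose proof (mean_Re L r m ltac:(lra) HL ltac:(unfold m; lia)) as Hmean.
    pose proof (remainder_decr L r n m ltac:(lra) ltac:(unfold m; lia)) as Hdec. fold e in Hdec.
    rewrite HL0, re_RtoC in Hmean. apply Rabs_le_between in Hmean.
    apply Rle_trans with (rsum (fun k => Re (ev L (circle r m k)) + 2 * q k) m).
    - apply rsum_le. intros k Hkm. destruct (Hx k Hkm) as [Q1 [Q2 Q3]].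
      unfold Rabs. destruct Rcase_abs; lra.
    - rewrite rsum_plus, rsum_scal.
      assert (rsum (fun k => Re (ev L (circle r m k))) m <= (kappa + e) * INR m).
      { apply Rle_div_l; [assumption|]. lra. }
      lra. }
  assert (HLam : 0 <= Lam) by (unfold Lam; lra).
  assert (HLr : summable L (r / 2)) by (apply (summable_radius L (r / 2) r); [lra|assumption]).
  apply Rle_trans with (Cmod (ev L z)).
  { eapply Rle_trans; [apply Rle_abs|apply re_le_Cmod]. }
  eapply Rle_trans; [apply (Cmod_ev L (r / 2) z Hz HLr)|].
  assert (Hpart : partial_norm L (r / 2) (S n) <= kappa + Lam).
  { unfold partial_norm. rewrite rsum_S_l. rewrite HL0, Cmod_R, Rabs_pos_eq by assumption.
    apply Rplus_le_compat; [simpl; lra|].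
    apply Rle_trans with (rsum (fun k => Lam / 2 * (1 / 2) ^ k) n).
    - apply rsum_le. intros k Hkn.
      replace (Cmod (L (S k)) * (r / 2) ^ S k) with ((Cmod (L (S k)) * r ^ S k) * (1 / 2) ^ S k).
      2:{ rewrite Rmult_assoc, <- Rpow_mult_distr. do 2 f_equal. field. }
      replace (Lam / 2 * (1 / 2) ^ k) with (Lam * (1 / 2) ^ S k) by (simpl; field).
      apply Rmult_le_compat_r; [apply pow_le; lra|]. apply Hcoef. lia.
    - rewrite rsum_scal. pose proof (rsum_geom_le (1 / 2) n ltac:(lra)) as Hg.
      replace (/ (1 - 1 / 2)) with 2 in Hg by field.
      apply Rle_trans with (Lam / 2 * 2); [apply Rmult_le_compat_l; [lra|exact Hg]|lra]. }
  assert (Htail : l1norm L (r / 2) - partial_norm L (r / 2) (S n) <= e).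
  { apply Rle_trans with (remainder L r (S n)).
    - unfold remainder.
      assert (Hd : forall N, partial_norm L (r / 2) (S n + N) - partial_norm L (r / 2) (S n) <=
         partial_norm L r (S n + N) - partial_norm L r (S n)).
      { induction N as [|N IH]; [rewrite Nat.add_0_r; lra|].
        rewrite Nat.add_succ_r. unfold partial_norm in *. cbn [rsum] in *.
        assert (Cmod (L (S n + N)%nat) * (r / 2) ^ (S n + N) <= Cmod (L (S n + N)%nat) * r ^ (S n + N)).
        { apply Rmult_le_compat_l; [apply Cmod_ge_0|]. apply pow_incr. lra. }
        lra. }
      assert (l1norm L (r / 2) <= partial_norm L (r / 2) (S n) + (l1norm L r - partial_norm L r (S n))).
      { apply (summable_bounded L (r / 2)); [lra|]. intros N.
        apply Rle_trans with (partial_norm L (r / 2) (S n + N)); [apply partial_norm_incr; [lra|lia]|].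
        specialize (Hd N). pose proof (partial_norm_le L r (S n + N) ltac:(lra) HL). lra. }
      lra.
    - apply remainder_decr; [lra|lia]. }
  unfold Lam in Hpart. lra.
Qed.

(** It exceeds [4^3 * 7^4 * 3 = 460992] by 8: the main term is
    [exp (3 kappa + 4 ln 7 + 1)] with [exp kappa <= 4 / d^p] and [exp 1 <= 3], and the
    excess accounts for adding back [|c| < 3 S]. *)
Definition growth_constant : R := 461000.

Lemma growth a p d : let S := l1norm a d in
  0 < d <= 1 / 8 -> summable a (3 / 4) -> (forall c, takes_at_most p a c) ->
  (exists k, (1 <= k)%nat /\ a k <> RtoC 0) ->
  forall z, Cmod z <= 1 / 256 -> Cmod (ev a z) <= growth_constant * S / d ^ (3 * p).
Proof.
  intros S Hd Ha Hval [k0 [Hk0 Hak]] z Hz.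
  assert (Had : summable a d) by (apply (summable_radius a d (3 / 4)); [lra|assumption]).
  assert (HS : 0 < S) by (apply (l1norm_pos a d k0); [lra|assumption|assumption]).
  assert (Hea : summable (euler a) (7 / 10)) by (apply (summable_euler a _ (3 / 4)); [lra|assumption]).
  destruct (finite_roots (euler a) (7 / 10) (1 / 8) ltac:(lra) ltac:(lra) Hea) as [crit Hcrit].
  { exists k0. unfold euler. apply Cmult_neq_0; [|assumption].
    intros H. apply RtoC_inj in H. revert H. apply not_0_INR. lia. }
  (* n is fixed before c: B bounds the coefficients of L for every admissible c *)
  set (B := 2 * ln (4 ^ p * (l1norm a (3 / 4) + 3 * S) / S)).
  destruct (pow_half_small (10 * Rabs B) 1) as [n [Hn HnB]]; [pose proof (Rabs_pos B); lra|lra|].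
  set (m := (Datatypes.S n + Datatypes.S n)%nat).
  destruct (exists_remote_value (fun k => ev a (circle (1 / 128) m k)) (map (ev a) crit) S m HS)
    as [c [Hc [HcE [Hcw Hcsum]]]].
  destruct (log_majorant a p d c Hd Ha (Hval c) HS Hc) as [kappa [L [HL0 [Hk [Hek [HL [HLB HLev]]]]]]].
  { intros w Hw Hw0 Hwc. apply HcE. rewrite <- Hwc. apply in_map. apply Hcrit. now split. }
  assert (HLr : summable L (1 / 128)) by (apply (summable_radius L _ (1 / 32)); [lra|assumption]).
  assert (Hrem : 5 * remainder L (1 / 128) n <= 1).
  { assert (remainder L (1 / 128) n <= Rabs B * (1 / 2) ^ n / (1 - 1 / 2)).
    { apply remainder_geom; try assumption; try lra; [apply Rabs_pos|].
      intros j Hj. replace (1 / 128) with (1 / 64 * (1 / 2)) by field.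
      rewrite Rpow_mult_distr, <- Rmult_assoc. apply Rmult_le_compat_r; [apply pow_le; lra|].
      eapply Rle_trans; [apply HLB; lia|]. apply Rle_abs. }
    lra. }
  pose proof (Re_le_of_negative_part L kappa (ln 7)
    (fun k => ln (Cmod (ev a (circle (1 / 128) m k) - c)%C / S)) (1 / 128) n
    (fun k => Rmax 0 (- ln (Cmod (ev a (circle (1 / 128) m k) - c)%C / S)))
    ltac:(lra) HLr HL0 Hk) as HRe.
  fold m in HRe.
  assert (Hlog : Re (ev L z) <= 3 * kappa + 4 * ln 7 + 1).
  { eapply Rle_trans; [apply HRe; [|exact Hcsum|lra]|lra].
    intros k Hkm. split; [apply Rmax_r|]. split; [apply Rmax_l|].
    apply HLev; [rewrite Cmod_circle; lra|now apply Hcw]. }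
  assert (Hdp : 0 < d ^ p) by (apply pow_lt; lra).
  assert (Hdp1 : d ^ p <= 1) by (rewrite <- (pow1 p); apply pow_incr; lra).
  replace (d ^ (3 * p)) with (d ^ p * d ^ p * d ^ p) by (rewrite <- !pow_add; f_equal; lia).
  set (D := d ^ p) in *.
  assert (HD3 : 0 < D * D * D) by (repeat apply Rmult_lt_0_compat; assumption).
  assert (HD31 : D * D * D <= 1) by nra.
  assert (Hexp : exp (3 * kappa + 4 * ln 7 + 1) <= 460992 / (D * D * D)).
  { replace (3 * kappa + 4 * ln 7 + 1) with
      (kappa + (kappa + (kappa + (ln 7 + (ln 7 + (ln 7 + (ln 7 + 1))))))) by ring.
    rewrite !exp_plus, !exp_ln by lra.
    pose proof exp_le_3 as He3. pose proof (exp_pos 1) as He0. pose proof (exp_pos kappa) as Hk0'.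
    replace (460992 / (D * D * D)) with
      ((4 / D) * ((4 / D) * ((4 / D) * (7 * (7 * (7 * (7 * 3))))))) by (field; lra).
    repeat (apply Rmult_le_compat; [lra| |assumption|]; [repeat apply Rmult_le_pos; lra|]).
    lra. }
  assert (Hmain : Cmod (ev a z - c)%C <= 460992 / (D * D * D) * S).
  { destruct (Ceq_dec (ev a z) c) as [->|Hne].
    - replace (c - c)%C with (RtoC 0) by ring. rewrite Cmod_0.
      apply Rmult_le_pos; [apply Rdiv_le_0_compat; lra|lra].
    - assert (H0 : 0 < Cmod (ev a z - c)%C) by (apply Cmod_gt_0; now apply Cminus_eq_contra).
      apply Rle_div_l; [assumption|].
      rewrite <- (exp_ln (Cmod (ev a z - c)%C / S)) by now apply Rdiv_lt_0_compat.
      eapply Rle_trans; [|apply Hexp].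
      assert (Hle : ln (Cmod (ev a z - c)%C / S) <= 3 * kappa + 4 * ln 7 + 1).
      { eapply Rle_trans; [apply HLev; [lra|assumption]|assumption]. }
      destruct Hle as [Hlt|Heq]; [left; now apply exp_increasing|right; now rewrite Heq]. }
  replace (ev a z) with ((ev a z - c) + c)%C by ring.
  eapply Rle_trans; [apply Cmod_triangle|].
  unfold growth_constant.
  replace (461000 * S / (D * D * D)) with
    (460992 / (D * D * D) * S + 8 * S / (D * D * D)) by (field; lra).
  apply Rplus_le_compat; [assumption|].
  apply (proj1 (Rle_div_r _ _ _ HD3)). nra.
Qed.

(** Small enough for the coefficients of index at least [4 p] to carry at most half of
    the norm, see [domination]. *)
Definition small_radius : R := / (4 * growth_constant * 256 ^ 4).

Lemma small_radius_bounds : 0 < small_radius /\ 256 * small_radius <= 1 / 2 /\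
  growth_constant * (256 ^ 4 * small_radius) = 1 / 4.
Proof.
  unfold small_radius, growth_constant. split; [apply Rinv_0_lt_compat; lra|]. split; [|field].
  apply Rmult_le_reg_r with (4 * 461000 * 256 ^ 4); [lra|].
  rewrite Rmult_assoc, Rinv_l by lra. lra.
Qed.

(** The growth bound loses [d^(-3p)], while the terms of index [k >= 4p] gain [d^k];
    the surplus [d^p] beats the constants. *)
Lemma domination a p : let d := small_radius in let S := l1norm a d in
  (1 <= p)%nat -> summable a (3 / 4) -> (forall c, takes_at_most p a c) ->
  (exists k, (1 <= k)%nat /\ a k <> RtoC 0) ->
  (forall k, Cmod (a k) <= growth_constant * S / d ^ (3 * p) * 256 ^ k) /\
  S <= 2 * partial_norm a d (4 * p).
Proof.
  intros d S Hp Ha Hval Hnc. destruct small_radius_bounds as [Hd1 [Hd2 Hd3]]. fold d in Hd1, Hd2, Hd3.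
  assert (Had : summable a d) by (apply (summable_radius a d (3 / 4)); [lra|assumption]).
  assert (HS0 : 0 <= S) by (apply l1norm_nonneg; [lra|assumption]).
  set (M := growth_constant * S / d ^ (3 * p)).
  assert (HM : 0 <= M).
  { apply Rdiv_le_0_compat; [|apply pow_lt; lra].
    apply Rmult_le_pos; [unfold growth_constant; lra|assumption]. }
  assert (Hcoef : forall k, Cmod (a k) * (1 / 256) ^ k <= M).
  { intros k. apply cauchy_estimate; [lra| |].
    - apply (summable_radius a _ (3 / 4)); [lra|assumption].
    - intros z Hz. apply (growth a p d); try assumption; lra. }
  assert (Hcoef' : forall k, Cmod (a k) <= M * 256 ^ k).
  { intros k. apply Rmult_le_reg_r with ((1 / 256) ^ k); [apply pow_lt; lra|].
    rewrite Rmult_assoc, <- Rpow_mult_distr. replace (256 * (1 / 256)) with 1 by field.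
    rewrite pow1, Rmult_1_r. apply Hcoef. }
  split; [exact Hcoef'|].
  assert (Hrem : remainder a d (4 * p) <= M * (256 * d) ^ (4 * p) / (1 - 256 * d)).
  { apply remainder_geom; try assumption; try lra. intros j _.
    rewrite Rpow_mult_distr, <- Rmult_assoc. apply Rmult_le_compat_r; [apply pow_le; lra|apply Hcoef']. }
  assert (HMp : M * (256 * d) ^ (4 * p) = growth_constant * S * (256 ^ 4 * d) ^ p).
  { unfold M. rewrite !Rpow_mult_distr, <- !pow_mult.
    replace (d ^ (4 * p)) with (d ^ (3 * p) * d ^ p) by (rewrite <- pow_add; f_equal; lia).
    field. apply pow_nonzero. lra. }
  assert (Hx : (256 ^ 4 * d) ^ p <= 256 ^ 4 * d).
  { unfold growth_constant in Hd3.
    rewrite <- (pow_1 (256 ^ 4 * d)) at 2. apply pow_decr; [lra|assumption]. }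
  assert (Hfin : M * (256 * d) ^ (4 * p) <= S * (1 / 4)).
  { rewrite HMp, <- Hd3.
    replace (S * (growth_constant * (256 ^ 4 * d))) with (growth_constant * S * (256 ^ 4 * d)) by ring.
    apply Rmult_le_compat_l; [|assumption].
    apply Rmult_le_pos; [unfold growth_constant; lra|assumption]. }
  assert (Hhalf : remainder a d (4 * p) <= S / 2).
  { eapply Rle_trans; [apply Hrem|]. apply Rle_div_l; [lra|]. nra. }
  unfold remainder in Hhalf. fold S in Hhalf. lra.
Qed.

(** * Power series in the sense of limits of partial sums *)

Lemma sqrt2_le_2 : sqrt 2 <= 2.
Proof. pose proof (sqrt_sqrt 2 ltac:(lra)). pose proof (sqrt_pos 2). nra. Qed.

Lemma pow_n_Cpow (z : C) k : pow_n (K := C_AbsRing) z k = (z ^ k)%C.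
Proof. induction k as [|k IH]; [reflexivity|]. cbn [pow_n Cpow]. now rewrite IH. Qed.

Lemma sum_n_psum (a : nat -> C) z n :
  sum_n (G := C_AbelianGroup) (fun k => scal (V := C_NormedModule) (pow_n (K := C_AbsRing) z k) (a k)) n
    = psum a z (S n).
Proof.
  unfold psum. induction n as [|n IH].
  - rewrite sum_O. cbn [csum]. change (1 * a O = 0 + a O * 1)%C. ring.
  - rewrite sum_Sn, IH.
    change (csum (fun k => a k * z ^ k)%C (S n) + pow_n (K := C_AbsRing) z (S n) * a (S n) =
      csum (fun k => a k * z ^ k)%C (S n) + a (S n) * z ^ S n)%C.
    rewrite (pow_n_Cpow z (S n)). ring.
Qed.

Lemma is_pseries_ev a r z : Cmod z <= r -> summable a r ->
  is_pseries (K := C_AbsRing) (V := C_NormedModule) a z (ev a z).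
Proof.
  intros Hz Ha. apply filterlim_locally. intros eps.
  pose proof (psum_lim a r z Hz Ha) as H. apply is_lim_seq_incr_1, is_lim_seq_spec in H.
  destruct (H eps) as [N HN]. exists N. intros n Hn. specialize (HN n Hn).
  apply C_NormedModule_mixin_compat1. rewrite sum_n_psum.
  rewrite Rminus_0_r, Rabs_pos_eq in HN by apply Cmod_ge_0. exact HN.
Qed.

Lemma is_pseries_inj (a : nat -> C) z v w :
  is_pseries (K := C_AbsRing) (V := C_NormedModule) a z v ->
  is_pseries (K := C_AbsRing) (V := C_NormedModule) a z w -> v = w.
Proof. apply (filterlim_locally_unique (V := C_NormedModule)). Qed.

Lemma CPSeries_ev a r z : Cmod z <= r -> summable a r -> CPSeries a z = ev a z.
Proof.
  intros Hz Ha. pose proof (is_pseries_ev a r z Hz Ha) as H.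
  apply (iota_unique (V := C_CompleteNormedModule)); [|exact H].
  intros y Hy. exact (is_pseries_inj a z y (ev a z) Hy H).
Qed.

Lemma summable_of_is_pseries a s v r : 0 <= r < s ->
  is_pseries (K := C_AbsRing) (V := C_NormedModule) a (RtoC s) v -> summable a r.
Proof.
  intros Hr H.
  destruct (proj1 (filterlim_locally _ _) H (mkposreal 1 Rlt_0_1)) as [N HN].
  pose proof sqrt2_le_2 as Hsq.
  assert (Hps : forall n, (N < n)%nat -> Cmod (psum a s n - v)%C <= 2).
  { intros [|n] Hn; [lia|]. specialize (HN n ltac:(lia)). apply C_NormedModule_mixin_compat2 in HN.
    rewrite sum_n_psum in HN. cbn [pos] in HN.
    change (Cmod (psum a s (S n) - v)%C < sqrt 2 * 1) in HN. lra. }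
  assert (Hbig : forall k, (N < k)%nat -> Cmod (a k) * s ^ k <= 4).
  { intros k Hk. pose proof (Hps k Hk) as H1. pose proof (Hps (S k) ltac:(lia)) as H2.
    replace (Cmod (a k) * s ^ k) with (Cmod (a k * RtoC s ^ k)%C).
    2:{ rewrite Cmod_mult, Cmod_pow, Cmod_R, Rabs_pos_eq; lra. }
    replace (a k * RtoC s ^ k)%C with ((psum a s (S k) - v) + - (psum a s k - v))%C
      by (unfold psum; cbn [csum]; ring).
    eapply Rle_trans; [apply Cmod_triangle|]. rewrite Cmod_opp. lra. }
  assert (Hs0 : 0 <= s) by lra.
  pose proof (partial_norm_nonneg a s (S N) Hs0) as Hp.
  apply (summable_of_bound a r s (partial_norm a s (S N) + 4)); [lra|lra|].
  intros k. destruct (le_lt_dec k N) as [Hk|Hk]; [|specialize (Hbig k Hk); lra].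
  pose proof (partial_norm_incr a s (S k) (S N) Hs0 ltac:(lia)) as Hi.
  pose proof (partial_norm_nonneg a s k Hs0) as Hk0.
  unfold partial_norm in *. cbn [rsum] in *. lra.
Qed.

(** With [q] the quotient of the series by [y - z], the difference quotient at [y] is
    [ev q y], and [ev q] is Lipschitz. *)
Lemma ex_derive_ev b r z : Cmod z < r -> summable b r ->
  ex_derive (K := C_AbsRing) (V := C_NormedModule) (ev b) z.
Proof.
  intros Hz Hb. pose proof (Cmod_ge_0 z) as Hz0.
  set (q := quot b z). set (s := (Cmod z + r) / 2).
  assert (Hs : Cmod z < s < r) by (unfold s; lra).
  destruct (summable_quot b r z Hz Hb) as [Hq _]. fold q in Hq.
  set (K := 2 / (r - Cmod z) * l1norm q r).
  assert (HK : 0 <= K).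
  { apply Rmult_le_pos; [apply Rdiv_le_0_compat; lra|apply l1norm_nonneg; (lra || assumption)]. }
  exists (ev q z). split; [apply is_linear_scal_l|].
  intros x Hx eps.
  assert (Ex : z = x) by exact (is_filter_lim_locally_unique (V := AbsRing_NormedModule C_AbsRing) z x Hx).
  subst x.
  assert (Hdel : 0 < Rmin (s - Cmod z) (eps / (K + 1))).
  { pose proof (cond_pos eps). apply Rmin_glb_lt; [lra|apply Rdiv_lt_0_compat; lra]. }
  exists (mkposreal _ Hdel). intros y Hy.
  change (Cmod (y - z)%C < Rmin (s - Cmod z) (eps / (K + 1))) in Hy.
  pose proof (Rmin_l (s - Cmod z) (eps / (K + 1))) as M1.
  pose proof (Rmin_r (s - Cmod z) (eps / (K + 1))) as M2.
  assert (Hyr : Cmod y <= r).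
  { assert (Cmod y <= Cmod (y - z)%C + Cmod z); [|lra].
    replace y with ((y - z) + z)%C at 1 by ring. apply Cmod_triangle. }
  change (Cmod (ev b y - ev b z - (y - z) * ev q z)%C <= eps * Cmod (y - z)%C).
  rewrite (ev_quot b r z y Hz Hyr Hb). fold q.
  replace ((y - z) * ev q y + ev b z - ev b z - (y - z) * ev q z)%C with
    ((ev q y - ev q z) * (y - z))%C by ring.
  rewrite Cmod_mult. apply Rmult_le_compat_r; [apply Cmod_ge_0|].
  eapply Rle_trans; [apply (ev_lipschitz q r z y Hz Hyr Hq)|]. fold K.
  apply Rle_trans with (K * (eps / (K + 1))); [apply Rmult_le_compat_l; lra|].
  pose proof (cond_pos eps).
  replace (K * (eps / (K + 1))) with (eps * (K / (K + 1))) by (field; lra).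
  rewrite <- (Rmult_1_r eps) at 2. apply Rmult_le_compat_l; [lra|]. apply Rle_div_l; lra.
Qed.

(** * Counting values of the Borel transform *)

Definition borel (a : nat -> C) (k : nat) : C := (a k / RtoC (INR (fact k)))%C.

Lemma Cmod_borel a k : Cmod (borel a k) = Cmod (a k) / INR (fact k).
Proof.
  unfold borel. pose proof (INR_fact_lt_0 k).
  rewrite Cmod_div, Cmod_R, Rabs_pos_eq; [reflexivity|lra|].
  intros H0. apply RtoC_inj in H0. lra.
Qed.

Lemma borel_norm a M Q r : 0 <= M -> 0 <= Q -> 0 <= r ->
  (forall k, Cmod (a k) <= M * Q ^ k) ->
  summable (borel a) r /\ l1norm (borel a) r <= M * exp (Q * r).
Proof.
  intros HM HQ Hr Ha.
  assert (Hx : 0 <= Q * r) by now apply Rmult_le_pos.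
  assert (Hexp : is_lim_seq (rsum (fun k => / INR (fact k) * (Q * r) ^ k)) (exp (Q * r))).
  { apply is_lim_seq_rsum. pose proof (is_exp_Reals (Q * r)) as He.
    apply is_pseries_R in He. exact He. }
  apply summable_bounded; [assumption|]. intros n.
  apply Rle_trans with (M * rsum (fun k => / INR (fact k) * (Q * r) ^ k) n).
  - unfold partial_norm. rewrite <- rsum_scal. apply rsum_le. intros k _.
    rewrite Cmod_borel, Rpow_mult_distr.
    replace (M * (/ INR (fact k) * (Q ^ k * r ^ k))) with ((M * Q ^ k) / INR (fact k) * r ^ k)
      by (unfold Rdiv; ring).
    apply Rmult_le_compat_r; [now apply pow_le|].
    apply Rmult_le_compat_r; [left; apply Rinv_0_lt_compat, INR_fact_lt_0|apply Ha].
  - apply Rmult_le_compat_l; [assumption|].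
    refine (is_lim_seq_incr_compare _ _ Hexp _ n). intros k. cbn [rsum].
    assert (0 <= / INR (fact k) * (Q * r) ^ k); [|lra].
    apply Rmult_le_pos; [left; apply Rinv_0_lt_compat, INR_fact_lt_0|now apply pow_le].
Qed.

Lemma fact_le_pow n : (fact n <= n ^ n)%nat.
Proof.
  assert (H : forall k, (k <= n)%nat -> (fact k <= n ^ k)%nat).
  { induction k as [|k IH]; intros Hk; [simpl; lia|].
    cbn [fact Nat.pow]. specialize (IH ltac:(lia)). nia. }
  now apply H.
Qed.

(** Dividing by factorials costs at most [(4p)!] on the coefficients that carry the
    norm of [a], and turns the geometric growth of the coefficients into an exponential. The
    number 2304 is [256 * 9]. *)
Lemma borel_root_count a p rho l : (1 <= p)%nat -> 1 < rho -> summable a (3 / 4) ->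
  (forall c, takes_at_most p a c) -> (exists k, (1 <= k)%nat /\ a k <> RtoC 0) ->
  NoDup l -> (forall z, In z l -> Cmod z <= rho /\ ev (borel a) z = RtoC 0) ->
  2 ^ length l <= 2 * INR (fact (4 * p)) *
    (growth_constant / small_radius ^ (3 * p) * exp (2304 * rho)).
Proof.
  intros Hp Hrho Ha Hval Hnc Hnd Hl.
  destruct (domination a p Hp Ha Hval Hnc) as [Hdom HS2].
  destruct small_radius_bounds as [Hd1 [Hd2 _]].
  set (d := small_radius) in *. set (S := l1norm a d) in *.
  assert (Had : summable a d) by (apply (summable_radius a d (3 / 4)); [lra|assumption]).
  assert (HS : 0 < S).
  { destruct Hnc as [k [_ Hk]]. now apply (l1norm_pos a d k). }
  assert (Hdp : 0 < d ^ (3 * p)) by (apply pow_lt; lra).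
  set (M := growth_constant * S / d ^ (3 * p)) in *.
  assert (HM : 0 <= M).
  { apply Rdiv_le_0_compat; [|assumption].
    apply Rmult_le_pos; [unfold growth_constant; lra|lra]. }
  destruct (borel_norm a M 256 (9 * rho) HM ltac:(lra) ltac:(lra) Hdom) as [Hb Hbn].
  pose proof (root_count (borel a) l (9 * rho) 1 rho ltac:(lra) ltac:(lra) ltac:(lra) Hb Hnd Hl) as Hrc.
  assert (Hb1 : summable (borel a) 1) by (apply (summable_radius _ 1 (9 * rho)); [lra|assumption]).
  assert (HF : 0 < INR (fact (4 * p))) by apply INR_fact_lt_0.
  assert (Hlow : S <= 2 * INR (fact (4 * p)) * l1norm (borel a) 1).
  { eapply Rle_trans; [apply HS2|]. rewrite Rmult_assoc. apply Rmult_le_compat_l; [lra|].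
    apply Rle_trans with (INR (fact (4 * p)) * partial_norm (borel a) 1 (4 * p)).
    - unfold partial_norm. rewrite <- rsum_scal. apply rsum_le. intros k Hk.
      rewrite Cmod_borel, pow1, Rmult_1_r.
      pose proof (INR_fact_lt_0 k) as Hfk. pose proof (Cmod_ge_0 (a k)) as Hak.
      assert (Hfl : INR (fact k) <= INR (fact (4 * p))) by (apply le_INR, fact_le; lia).
      apply Rle_trans with (Cmod (a k) * 1).
      + apply Rmult_le_compat_l; [assumption|]. rewrite <- (pow1 k). apply pow_incr. lra.
      + replace (INR (fact (4 * p)) * (Cmod (a k) / INR (fact k))) with
          (Cmod (a k) * (INR (fact (4 * p)) / INR (fact k))) by (field; lra).
        apply Rmult_le_compat_l; [assumption|]. apply Rle_div_r; lra.
    - apply Rmult_le_compat_l; [lra|]. apply partial_norm_le; [lra|assumption]. }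
  assert (H2n : 0 < 2 ^ length l) by (apply pow_lt; lra).
  replace (256 * (9 * rho)) with (2304 * rho) in Hbn by ring.
  apply Rmult_le_reg_r with S; [assumption|].
  apply Rle_trans with (2 * INR (fact (4 * p)) * (2 ^ length l * l1norm (borel a) 1)).
  { replace (2 * INR (fact (4 * p)) * (2 ^ length l * l1norm (borel a) 1)) with
      (2 ^ length l * (2 * INR (fact (4 * p)) * l1norm (borel a) 1)) by ring.
    apply Rmult_le_compat_l; lra. }
  replace (2 * INR (fact (4 * p)) * (growth_constant / d ^ (3 * p) * exp (2304 * rho)) * S) with
    (2 * INR (fact (4 * p)) * (M * exp (2304 * rho))) by (unfold M; field; lra).
  apply Rmult_le_compat_l; [lra|]. lra.
Qed.

Lemma log_root_bound p rho n : (1 <= p)%nat ->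
  2 ^ n <= 2 * INR (fact (4 * p)) * (growth_constant / small_radius ^ (3 * p) * exp (2304 * rho)) ->
  INR n * ln 2 <= ln (2 * growth_constant) + 4 * INR p * (ln 4 + ln (INR p))
    + 3 * INR p * ln (/ small_radius) + 2304 * rho.
Proof.
  intros Hp H. destruct small_radius_bounds as [Hd1 _].
  assert (Hp0 : 0 < INR p) by (apply lt_0_INR; lia).
  assert (HC : 0 < growth_constant) by (unfold growth_constant; lra).
  assert (HD : 0 < / small_radius) by now apply Rinv_0_lt_compat.
  pose proof (exp_pos (2304 * rho)) as Hexp. pose proof (INR_fact_lt_0 (4 * p)) as Hf0.
  assert (Hf : INR (fact (4 * p)) <= (4 * INR p) ^ (4 * p)).
  { replace (4 * INR p) with (INR (4 * p)) by (rewrite mult_INR; simpl; ring).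
    rewrite <- pow_INR. apply le_INR, fact_le_pow. }
  assert (H' : 2 ^ n <= 2 * growth_constant *
     ((4 * INR p) ^ (4 * p) * ((/ small_radius) ^ (3 * p) * exp (2304 * rho)))).
  { eapply Rle_trans; [apply H|]. unfold Rdiv. rewrite <- pow_inv.
    replace (2 * INR (fact (4 * p)) * (growth_constant * (/ small_radius) ^ (3 * p) * exp (2304 * rho)))
      with (2 * growth_constant * (INR (fact (4 * p)) * ((/ small_radius) ^ (3 * p) * exp (2304 * rho))))
      by ring.
    apply Rmult_le_compat_l; [lra|]. apply Rmult_le_compat_r; [|assumption].
    apply Rmult_le_pos; [apply pow_le|]; lra. }
  assert (Hpp : 0 < (4 * INR p) ^ (4 * p)) by (apply pow_lt; lra).
  assert (Hqq : 0 < (/ small_radius) ^ (3 * p)) by (apply pow_lt; lra).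
  apply ln_le in H'; [|apply pow_lt; lra].
  rewrite ln_pow in H' by lra.
  rewrite (ln_mult (2 * growth_constant)), (ln_mult ((4 * INR p) ^ (4 * p))),
    (ln_mult ((/ small_radius) ^ (3 * p))), !ln_pow, ln_exp in H'
    by (repeat apply Rmult_lt_0_compat; lra).
  rewrite (ln_mult 4 (INR p)) in H' by lra.
  rewrite !mult_INR in H'. simpl (INR 4) in H'. simpl (INR 3) in H'. lra.
Qed.

Lemma takes_at_most_sub_const p a c : (forall r, 0 <= r < 1 -> summable a r) ->
  (forall v, takes_at_most p a v) -> forall v, takes_at_most p (sub_const a c) v.
Proof.
  intros Ha Hval v l Hnd Hl. apply (Hval (v + c)%C l Hnd). intros z Hz.
  destruct (Hl z Hz) as [H1 H2]. split; [assumption|]. pose proof (Cmod_ge_0 z).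
  rewrite (proj2 (ev_sub_const a c (Cmod z) z (Rle_refl _) (Ha (Cmod z) ltac:(lra)))) in H2.
  rewrite <- H2. ring.
Qed.

(** Otherwise [a O] would be taken at the [p + 1] points [i / (p + 1)] of the disk. *)
Lemma not_constant p a : (forall v, takes_at_most p a v) -> exists k, (1 <= k)%nat /\ a k <> RtoC 0.
Proof.
  intros Hval. apply NNPP. intros Hn.
  assert (H0 : forall k, a (S k) = RtoC 0).
  { intros k. apply NNPP. intros Hk. apply Hn. exists (S k). split; [lia|assumption]. }
  assert (Hp : 0 < INR (S p)) by (apply lt_0_INR; lia).
  specialize (Hval (a O) (map (fun i => RtoC (INR i / INR (S p))) (seq 0 (S p)))).
  rewrite length_map, length_seq in Hval.
  assert (Hbad : (S p <= p)%nat); [|lia]. apply Hval.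
  - apply Injective_map_NoDup; [|apply seq_NoDup].
    intros i j Hij. apply RtoC_inj in Hij. apply INR_eq.
    apply Rmult_eq_reg_r with (/ INR (S p)); [exact Hij|].
    apply Rinv_neq_0_compat. lra.
  - intros z Hz. apply in_map_iff in Hz. destruct Hz as [i [<- Hi]]. apply in_seq in Hi.
    pose proof (pos_INR i). split.
    + rewrite Cmod_R, Rabs_pos_eq by (apply Rdiv_le_0_compat; lra).
      apply Rlt_div_l; [assumption|]. rewrite Rmult_1_l. apply lt_INR. lia.
    + rewrite (ev_ext a (fun k => 0 * one k + a O * one k)%C).
      * rewrite (ev_lincomb _ _ _ _ (Cmod (RtoC (INR i / INR (S p))))), ev_one
          by (try apply summable_one; try apply Cmod_ge_0; lra). ring.
      * intros [|k]; [simpl; ring|]. rewrite H0. simpl. ring.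
Qed.

Theorem theorem3p1 :
  exists K : R, 0 < K /\
    forall (p : nat) (a : nat -> C) (f : C -> C) (rho : R),
      (1 <= p)%nat ->
      (forall z : C, disk 1 z ->
         is_pseries (K := C_AbsRing) (V := C_NormedModule) a z (f z)) ->
      valent p (disk 1) f ->
      1 < rho ->
      forall rho' : R, 0 < rho' < rho ->
        exists q : nat,
          (1 <= q)%nat /\
          INR q <= K * ((1 + ln (INR p) + ln rho) * INR p + rho) /\
          valent q (disk rho') (Borel_transform a).
Proof.
  destruct small_radius_bounds as [Hd1 [Hd2 _]].
  (* the coefficients of the bound of log_root_bound, divided by ln 2 below; the
     additional 1 in K pays for rounding up to an integer *)
  set (A := ln (2 * growth_constant)). set (D := ln (/ small_radius)).
  assert (HA : 0 <= A).
  { unfold A, growth_constant. rewrite <- ln_1. apply ln_le; lra. }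
  assert (HD : 0 <= D).
  { unfold D. rewrite <- ln_1. apply ln_le; [lra|].
    rewrite <- Rinv_1. apply Rinv_le_contravar; lra. }
  assert (H4 : 0 <= ln 4) by (rewrite <- ln_1; apply ln_le; lra).
  assert (H2 : 0 < ln 2) by (rewrite <- ln_1; apply ln_increasing; lra).
  set (K0 := A + 4 * ln 4 + 4 + 3 * D + 2304).
  exists (K0 / ln 2 + 1).
  assert (HK0 : 0 < K0 / ln 2) by (apply Rdiv_lt_0_compat; unfold K0; lra).
  split; [lra|].
  intros p a f rho Hp Hf [_ Hval] Hrho rho' Hrho'.
  assert (Ha : forall r, 0 <= r < 1 -> summable a r).
  { intros r Hr. apply (summable_of_is_pseries a ((r + 1) / 2) (f (RtoC ((r + 1) / 2)))); [lra|].
    apply Hf. unfold disk. rewrite Cmod_R, Rabs_pos_eq; lra. }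
  assert (Hfev : forall z, Cmod z < 1 -> ev a z = f z).
  { intros z Hz. apply (is_pseries_inj a z); [|now apply Hf]. pose proof (Cmod_ge_0 z).
    apply is_pseries_ev with (Cmod z); [lra|]. apply Ha. lra. }
  assert (Hvala : forall c, takes_at_most p a c).
  { intros c l Hnd Hl. apply (Hval c l Hnd). intros z Hz. destruct (Hl z Hz) as [Hz1 Hz2].
    split; [exact Hz1|]. now rewrite <- Hfev. }
  destruct (not_constant p a Hvala) as [k0 [Hk0 Hak0]].
  assert (Hb : forall r, 0 <= r -> summable (borel a) r).
  { intros r Hr. pose proof (Ha (1 / 2) ltac:(lra)) as Hh.
    apply (borel_norm a (l1norm a (1 / 2)) 2 r); try lra; [apply l1norm_nonneg; (lra || assumption)|].
    intros k. apply Rmult_le_reg_r with ((1 / 2) ^ k); [apply pow_lt; lra|].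
    rewrite Rmult_assoc, <- Rpow_mult_distr. replace (2 * (1 / 2)) with 1 by field.
    rewrite pow1, Rmult_1_r. apply term_le_l1norm; [lra|assumption]. }
  assert (HBev : forall z, Borel_transform a z = ev (borel a) z).
  { intros z. apply CPSeries_ev with (Cmod z); [lra|]. apply Hb, Cmod_ge_0. }
  assert (Hp1 : 1 <= INR p) by (apply (le_INR 1); assumption).
  assert (Hlp : 0 <= ln (INR p)) by (rewrite <- ln_1; apply ln_le; lra).
  assert (Hlr : 0 <= ln rho) by (rewrite <- ln_1; apply ln_le; lra).
  set (T := (1 + ln (INR p) + ln rho) * INR p + rho).
  set (X := (A + 4 * INR p * (ln 4 + ln (INR p)) + 3 * INR p * D + 2304 * rho) / ln 2).
  assert (HX0 : 0 <= X).
  { assert (0 <= INR p * (ln 4 + ln (INR p))) by (apply Rmult_le_pos; lra).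
    assert (0 <= INR p * D) by (apply Rmult_le_pos; lra).
    apply Rdiv_le_0_compat; lra. }
  assert (HT : 1 <= T /\ INR p <= T /\ INR p * ln (INR p) <= T /\ rho <= T).
  { assert (0 <= INR p * ln (INR p)) by (apply Rmult_le_pos; lra).
    assert (0 <= ln rho * INR p) by (apply Rmult_le_pos; lra). unfold T. repeat split; lra. }
  assert (HXT : X <= K0 / ln 2 * T).
  { replace (K0 / ln 2 * T) with (K0 * T / ln 2) by (field; lra).
    apply Rmult_le_compat_r; [left; now apply Rinv_0_lt_compat|]. unfold K0.
    assert (A * 1 <= A * T) by (apply Rmult_le_compat_l; lra).
    assert (ln 4 * INR p <= ln 4 * T) by (apply Rmult_le_compat_l; lra).
    assert (D * INR p <= D * T) by (apply Rmult_le_compat_l; lra). lra. }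
  destruct (archimed X) as [Hup1 Hup2].
  assert (Hz : (0 < up X)%Z) by (apply lt_IZR; lra).
  exists (Z.to_nat (up X)).
  assert (Hq : INR (Z.to_nat (up X)) = IZR (up X)).
  { rewrite INR_IZR_INZ, Z2Nat.id by lia. reflexivity. }
  split; [lia|]. split; [rewrite Hq; fold T; lra|]. split.
  - intros z _. apply (ex_derive_ext (ev (borel a))); [intros t; now rewrite HBev|].
    apply ex_derive_ev with (Cmod z + 1); [lra|]. apply Hb. pose proof (Cmod_ge_0 z); lra.
  - intros c l Hnd Hl.
    assert (Hroots : forall z, In z l -> Cmod z <= rho /\ ev (borel (sub_const a c)) z = RtoC 0).
    { intros z Hzl. destruct (Hl z Hzl) as [Hz1 Hz2]. unfold disk in Hz1. split; [lra|].
      rewrite (ev_ext _ (sub_const (borel a) c)).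
      - rewrite (proj2 (ev_sub_const (borel a) c (Cmod z) z (Rle_refl _) (Hb _ (Cmod_ge_0 z)))).
        rewrite <- HBev, Hz2. ring.
      - intros k. unfold borel, sub_const. destruct k; simpl one.
        + simpl fact. simpl INR. field.
        + unfold Cdiv. ring. }
    assert (Hsum : summable (sub_const a c) (3 / 4)).
    { apply (ev_sub_const a c (3 / 4) 0); [rewrite Cmod_0; lra|apply Ha; lra]. }
    pose proof (borel_root_count (sub_const a c) p rho l Hp Hrho Hsum
      (takes_at_most_sub_const p a c Ha Hvala)) as Hcount.
    apply (log_root_bound p rho (length l) Hp) in Hcount; try assumption.
    + fold A D in Hcount.
      assert (Hlen : INR (length l) <= X) by (apply Rle_div_r; assumption).
      apply INR_le. rewrite Hq. lra.
    + exists k0. split; [assumption|]. unfold sub_const.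
      destruct k0 as [|k]; [lia|]. simpl one.
      replace (1 * a (S k) + - c * 0)%C with (a (S k)) by ring. assumption.
Qed.
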